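(* Let $\mathcal{K}_0\hookrightarrow\mathcal{K}_1\hookrightarrow\cdots\hookrightarrow\mathcal{K}_m\hookrightarrow\mathcal{L}$ be a filtration of simplicial complexes, where $\mathcal{L}$ is $q$-non-branching and each $\mathcal{K}_i$ $(1\le i\le m)$ contains exactly one more $q$-simplex than $\mathcal{K}_{i-1}$. Then the sequence of up persistent Laplacians $\{\Delta_{q,\mathrm{up}}^{\mathcal{K}_i,\mathcal{L}}\}_{i=0}^m$ can be computed in $$O\left((m+1)\cdot(n_q^{\mathcal{K}_m})^2+(m+1)\cdot n_{q+1}^{\mathcal{L}}+(n_q^{\mathcal{L}}-n_q^{\mathcal{K}_m}+m)\cdot\alpha(n_{q+1}^{\mathcal{L}})\right)$$ arithmetic operations, where $\alpha(\cdot)$ is the inverse Ackermann function.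
   Context: Simplicial complexes are finite. For a complex $X$, $n_q^X$ is the number of $q$-simplices of $X$. $\mathcal{L}$ is $q$-non-branching if every $q$-simplex of $\mathcal{L}$ is a face of at most two $(q+1)$-simplices of $\mathcal{L}$. Fix an orientation of each simplex of $\mathcal{L}$ (inherited by subcomplexes); $C_q^X$ is the real vector space with basis the oriented $q$-simplices of $X$ and $\partial_q^X:C_q^X\to C_{q-1}^X$ is the boundary operator. Complexes $X$ carry positive weight functions $w^X$ on simplices, and $C_q^X$ has the inner product for which distinct oriented simplices are orthogonal and $\langle[\sigma],[\sigma]\rangle=w^X(\sigma)^{-1}$. For a subcomplex $\mathcal{K}\hookrightarrow\mathcal{L}$ set $C_{q+1}^{\mathcal{L},\mathcal{K}}=\{c\in C_{q+1}^{\mathcal{L}}:\partial_{q+1}^{\mathcal{L}}c\in C_q^{\mathcal{K}}\}$ with the inner product induced from $C_{q+1}^{\mathcal{L}}$, and let $\partial_{q+1}^{\mathcal{L},\mathcal{K}}:C_{q+1}^{\mathcal{L},\mathcal{K}}\to C_q^{\mathcal{K}}$ be the restriction of $\partial_{q+1}^{\mathcal{L}}$. The $q$-th up persistent Laplacian is $\partial_{q+1}^{\mathcal{L},\mathcal{K}}\circ(\partial_{q+1}^{\mathcal{L},\mathcal{K}})^{*}:C_q^{\mathcal{K}}\to C_q^{\mathcal{K}}$, where $*$ denotes the adjoint; $\Delta_{q,\mathrm{up}}^{\mathcal{K},\mathcal{L}}$ is its matrix in the basis of oriented $q$-simplices of $\mathcal{K}$. The input is the matrix of $\partial_{q+1}^{\mathcal{L}}$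 in compressed sparse row format, the indices of the $q$-simplices of the $\mathcal{K}_i$ (ordered so that the $q$-simplex added at step $i$ comes last among those of $\mathcal{K}_i$), and the diagonal weight matrices. *)

(* Defs.v *)
(* MathComp, with the real numbers as an arbitrary [R : realType] of
   MathComp-Analysis. *)
From HB Require Import structures.
From mathcomp Require Import all_boot all_order all_algebra all_fingroup.
From mathcomp Require Import reals.

Set Implicit Arguments.
Unset Strict Implicit.
Unset Printing Implicit Defensive.

Import Order.TTheory GRing.Theory Num.Theory.

Local Open Scope ring_scope.

(** * Simplicial complexes *)

Section Complexes.
Variable V : finType.
Implicit Types (X : {set {set V}}) (s t : {set V}) (p q : nat).

Definition simplicial_complex X : Prop :=
  set0 \notin X /\
  (forall s t, s \in X -> t \subset s -> t != set0 -> t \in X).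

Definition simplices q X : {set {set V}} := [set s in X | #|s| == q.+1].

Definition nsimplices q X : nat := #|simplices q X|.

Definition non_branching q X : Prop :=
  forall s, s \in simplices q X ->
    (#|[set t in simplices q.+1 X | s \subset t]| <= 2)%N.

(* An orientation of a simplex is given by a representative ordering of its
   vertices; two orderings define the same orientation when they differ by an
   even permutation. *)
Definition orientation X (o : {set V} -> seq V) : Prop :=
  forall s, s \in X -> perm_eq (o s) (enum s).

End Complexes.

(** * Chains and the persistent Laplacian *)

Section Chains.
Variables (R : realType) (V : finType).
Implicit Types (X K L : {set {set V}}) (s t : {set V}) (u v : seq V).
Implicit Types (o : {set V} -> seq V) (w : {set V} -> R) (p q : nat).

(* Chains of all dimensions live in one space of functions on vertex sets:
   [c s] is the coefficient of the oriented simplex [s]. In this way C_q(K) is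
   literally contained in C_q(L) when K is a subcomplex of L. *)
Definition chain := {ffun {set V} -> R}.
Implicit Types c d : chain.

Definition in_chains q X c : Prop :=
  forall s, s \notin simplices q X -> c s = 0.

Definition basis_chain s : chain := [ffun t => (t == s)%:R].

(* Sign of the permutation of the vertices that maps the ordering [u] to the
   ordering [v]; such a permutation is unique if it exists. *)
Definition reorder_sign u v : R :=
  if [pick g | perm_on [set x in u] (g : {perm V}) && (map g u == v)] is Some g
  then (-1) ^+ odd_perm g else 0.

(* Coefficient of the oriented simplex [s] in the oriented simplex given by
   the ordering [u]. *)
Definition oriented_coef o u s : R :=
  if s == [set x in u] then reorder_sign u (o s) else 0.

(* Coefficient of [s] in the boundary of the oriented simplex [t], that is in
   the sum over i of (-1)^i [v_0, .., v_(i-1), v_(i+1), .., v_p], where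
   [v_0, .., v_p] is the orientation of [t]. *)
Definition boundary_coef o t s : R :=
  \sum_(i < size (o t))
     (-1) ^+ i * oriented_coef o (take i (o t) ++ drop i.+1 (o t)) s.

Definition boundary o p X c : chain :=
  [ffun s => \sum_(t in simplices p X) c t * boundary_coef o t s].

Definition chain_inner w q X c d : R :=
  \sum_(s in simplices q X) (w s)^-1 * (c s * d s).

(* The space C_(q+1)(L, K) of (q+1)-chains of L with boundary in C_q(K). *)
Definition in_rel_chains o q K L c : Prop :=
  in_chains q.+1 L c /\ in_chains q K (boundary o q.+1 L c).

(* [f : C_q(K) -> C_(q+1)(L, K)] is the adjoint of the restriction of the
   boundary operator to C_(q+1)(L, K). The inner products being positive
   definite, this determines [f] on C_q(K), and forces its linearity. *)
Definition boundary_adjoint o q K L wK wL (f : chain -> chain) : Prop :=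
  (forall d, in_chains q K d -> in_rel_chains o q K L (f d)) /\
  (forall c d, in_rel_chains o q K L c -> in_chains q K d ->
     chain_inner wK q K (boundary o q.+1 L c) d
     = chain_inner wL q.+1 L c (f d)).

(* [D] is the matrix of the q-th up persistent Laplacian of (K, L) in the basis
   of the oriented q-simplices of K, listed in the order of [ks]; column j
   holds the coordinates of the image of the j-th basis element. *)
Definition up_laplacian_matrix o q K L wK wL (ks : seq {set V}) (n : nat)
    (D : 'M[R]_n) : Prop :=
  exists2 f, boundary_adjoint o q K L wK wL f &
    D = \matrix_(i < n, j < n)
          boundary o q.+1 L (f (basis_chain (nth set0 ks j))) (nth set0 ks i).

(* Matrix of the p-th boundary operator, where [rs] lists the (p-1)-simplices
   and [cs] the p-simplices. *)
Definition boundary_matrix o (rs cs : seq {set V})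
    : 'M[R]_(size rs, size cs) :=
  \matrix_(i, j) boundary_coef o (nth set0 cs j) (nth set0 rs i).

End Chains.

(** * Compressed sparse row format *)

Record csr (R : Type) := CSR {
  row_ptr : seq nat;
  col_ind : seq nat;
  values : seq R
}.

(* The positions [row_ptr i, .., row_ptr i.+1 - 1] hold the nonzero entries of
   row [i], each of them once, in any order. *)
Definition csr_represents (R : realType) (r k : nat) (A : 'M[R]_(r, k))
    (S : csr R) : Prop :=
  let ptr i := nth 0%N (row_ptr S) i in
  [/\ size (row_ptr S) = r.+1,
      ptr 0%N = 0%N,
      ptr r = size (col_ind S),
      size (values S) = size (col_ind S) &
      forall i : 'I_r, (ptr i <= ptr i.+1)%N /\
        perm_eq [seq (nth 0%N (col_ind S) l, nth 0 (values S) l)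
                   | l <- index_iota (ptr i) (ptr i.+1)]
                [seq (val j, A i j) | j <- enum 'I_k & A i j != 0]].

(** * Real random access machine *)

(* Memory consists of integer arrays and real arrays, all of them named by
   natural numbers and unbounded; a program only refers to the finitely many
   arrays that occur in its text. A scalar variable is a cell of an array. *)
Record state (R : Type) := State {
  imem : nat -> nat -> nat;
  rmem : nat -> nat -> R
}.

Inductive nexp :=
  | NConst of nat
  | NLoad of nat & nexp
  | NAdd of nexp & nexp
  | NSub of nexp & nexp.

Inductive rexp :=
  | RConst of nat
  | RLoad of nat & nexp
  | RAdd of rexp & rexp
  | RSub of rexp & rexp
  | RMul of rexp & rexp
  | RDiv of rexp & rexp.

Inductive bexp :=
  | BNEq of nexp & nexp
  | BNLt of nexp & nexp
  | BREq of rexp & rexp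
  | BRLt of rexp & rexp
  | BNot of bexp
  | BAnd of bexp & bexp.

(* Programs do not depend on the field of scalars: real constants are
   numerals. *)
Inductive cmd :=
  | Skip
  | NStore of nat & nexp & nexp
  | RStore of nat & nexp & rexp
  | Seq of cmd & cmd
  | If of bexp & cmd & cmd
  | While of bexp & cmd.

(* Every arithmetic operation, comparison, connective, memory access and
   constant counts for one. *)
Fixpoint ncost (e : nexp) : nat :=
  match e with
  | NConst _ => 1
  | NLoad _ e1 => (ncost e1).+1
  | NAdd e1 e2 | NSub e1 e2 => (ncost e1 + ncost e2).+1
  end.

Fixpoint rcost (e : rexp) : nat :=
  match e with
  | RConst _ => 1
  | RLoad _ e1 => (ncost e1).+1
  | RAdd e1 e2 | RSub e1 e2 | RMul e1 e2 | RDiv e1 e2 =>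
      (rcost e1 + rcost e2).+1
  end.

Fixpoint bcost (b : bexp) : nat :=
  match b with
  | BNEq e1 e2 | BNLt e1 e2 => (ncost e1 + ncost e2).+1
  | BREq e1 e2 | BRLt e1 e2 => (rcost e1 + rcost e2).+1
  | BNot b1 => (bcost b1).+1
  | BAnd b1 b2 => (bcost b1 + bcost b2).+1
  end.

Section Semantics.
Variable R : realType.
Implicit Type st : state R.

(* Integer subtraction is truncated at 0, and real division by 0 gives 0. *)
Fixpoint neval st (e : nexp) : nat :=
  match e with
  | NConst k => k
  | NLoad a e1 => imem st a (neval st e1)
  | NAdd e1 e2 => (neval st e1 + neval st e2)%N
  | NSub e1 e2 => (neval st e1 - neval st e2)%N
  end.

Fixpoint reval st (e : rexp) : R :=
  match e with
  | RConst k => k%:R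
  | RLoad a e1 => rmem st a (neval st e1)
  | RAdd e1 e2 => reval st e1 + reval st e2
  | RSub e1 e2 => reval st e1 - reval st e2
  | RMul e1 e2 => reval st e1 * reval st e2
  | RDiv e1 e2 => reval st e1 / reval st e2
  end.

Fixpoint beval st (b : bexp) : bool :=
  match b with
  | BNEq e1 e2 => neval st e1 == neval st e2
  | BNLt e1 e2 => (neval st e1 < neval st e2)%N
  | BREq e1 e2 => reval st e1 == reval st e2
  | BRLt e1 e2 => reval st e1 < reval st e2
  | BNot b1 => ~~ beval st b1
  | BAnd b1 b2 => beval st b1 && beval st b2
  end.

Definition update (T : Type) (mem : nat -> nat -> T) (a i : nat) (x : T) :=
  fun a' i' => if (a' == a) && (i' == i) then x else mem a' i'.

(* [exec c st t st']: started in [st], the program [c] terminates in [st']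
   after [t] elementary operations. *)
Inductive exec : cmd -> state R -> nat -> state R -> Prop :=
  | ExecSkip st : exec Skip st 1 st
  | ExecNStore st a e1 e2 :
      exec (NStore a e1 e2) st (ncost e1 + ncost e2).+1
        (State (update (imem st) a (neval st e1) (neval st e2)) (rmem st))
  | ExecRStore st a e1 e2 :
      exec (RStore a e1 e2) st (ncost e1 + rcost e2).+1
        (State (imem st) (update (rmem st) a (neval st e1) (reval st e2)))
  | ExecSeq c1 c2 st t1 st1 t2 st2 :
      exec c1 st t1 st1 -> exec c2 st1 t2 st2 ->
      exec (Seq c1 c2) st (t1 + t2)%N st2
  | ExecIf b c1 c2 st t st' :
      exec (if beval st b then c1 else c2) st t st' ->
      exec (If b c1 c2) st (bcost b + t).+1 st'
  | ExecWhileFalse b c st :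
      ~~ beval st b -> exec (While b c) st (bcost b).+1 st
  | ExecWhileTrue b c st t1 st1 t2 st2 :
      beval st b -> exec c st t1 st1 -> exec (While b c) st1 t2 st2 ->
      exec (While b c) st (bcost b + t1 + t2).+1 st2.

(* Input layout. Integer arrays: 0 = the sizes [sizes], 1 and 2 = row pointers
   and column indices of the sparse matrix [S], 3 = the simplex indices [ks].
   Real arrays: 0 = values of [S], 1 and 2 = the diagonals [wK] and [wL]. All
   other cells are 0. *)
Definition input_state (sizes : seq nat) (S : csr R) (ks : seq nat)
    (wK wL : seq R) : state R :=
  State
    (fun a => nth 0%N (nth [::] [:: sizes; row_ptr S; col_ind S; ks] a))
    (fun a => nth 0 (nth [::] [:: values S; wK; wL] a)).

(* Output layout: real array 3 holds the matrices [D 0, .., D m] one after the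
   other, each of them row by row. *)
Definition outputs (m : nat) (n : nat -> nat) (D : forall i, 'M[R]_(n i)) st
    : Prop :=
  forall i, (i <= m)%N -> forall a b : 'I_(n i),
    rmem st 3 (\sum_(k < i) n k ^ 2 + a * n i + b)%N = D i a b.

End Semantics.

(** * Inverse Ackermann function *)

Fixpoint ackermann (m : nat) : nat -> nat :=
  match m with
  | 0 => succn
  | m'.+1 => fix ack_m n :=
      match n with
      | 0 => ackermann m' 1
      | n'.+1 => ackermann m' (ack_m n')
      end
  end.

Lemma ackermann_gt m n : (n < ackermann m n)%N.
Proof.
elim: m n => [|m IHm] n //; elim: n => [|n IHn].
  exact: leq_trans (IHm 1%N).
exact: leq_ltn_trans IHn (IHm _).
Qed.

Lemma inverse_ackermann_exists n :
  exists k, (0 < k)%N && (n <= ackermann k k)%N.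
Proof.
by exists n.+1; apply: ltnW (ltnW (ackermann_gt n.+1 n.+1)).
Qed.

(* The least k >= 1 such that n <= A(k, k). *)
Definition inverse_ackermann (n : nat) : nat :=
  ex_minn (inverse_ackermann_exists n).

(* Main.v *)
Require Import Defs.
From HB Require Import structures.
From mathcomp Require Import all_boot all_order all_algebra.
From mathcomp Require Import reals zify ring.

Set Implicit Arguments.
Unset Strict Implicit.
Unset Printing Implicit Defensive.

Import Order.TTheory GRing.Theory Num.Theory.

Local Open Scope ring_scope.

(** Number the q-simplices of L as rows and the (q+1)-simplices as columns of
    the boundary matrix. As L is q-non-branching, a row has at most two nonzero
    entries, so the condition that the boundary of a chain [c] does not meet the
    q-simplex [r] reads [v1 r * c (c1 r) + v2 r * c (c2 r) = 0]: it fixes the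
    ratio of two coefficients of [c], or makes one of them vanish. The relative
    chains of (L, K) are cut out by the rows outside K. View these rows as edges
    between columns: the values of such a chain on a connected component are
    determined up to one common factor, hence are multiples of one potential
    [x], which is 0 on a component whose constraints contradict each other. This
    is the predicate [param]: the relative chains are the
    [c t = y (lab t) * x t], where [lab t] names the component of [t] and [y] is
    arbitrary. The components give an orthogonal basis with disjoint supports, so
    the adjoint of the boundary is an explicit sum over components ([adjointP]),
    and an entry of the Laplacian is a sum of at most four terms, one for each
    pair of cofaces of the two q-simplices that lie in one component
    ([laplacian_entry]).

    The program goes down from K_m to K_0. For K_m the components and potentials
    are found by a graph search ([search_spec]) in time linear in the numbers of
    rows and columns, followed by a pass that detects contradictory components
    ([check_rows_spec], [param_potentials]). Passing from K_i to K_(i-1) adds one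
    constraint, which merges two components or annihilates one: the labels and
    potentials are rewritten in one pass over the columns ([param_merge]). Each
    of the m+1 stages thus takes time linear in the number of columns, plus
    constant time for each entry of its matrix.

    The rows of K_m are at most (n_q of K_m)^2 many and the others are counted
    by the last term of the bound, as the inverse Ackermann function is at least
    1; so the linear search stays within the bound ([prog_size_bound]). *)
(** * Reasoning about programs *)

(** Loop-free programs are evaluated as functions ([ceval] below), and their
    cost is bounded by the static quantity [ccost]. *)
Fixpoint straight (c : cmd) : bool :=
  match c with
  | Skip | NStore _ _ _ | RStore _ _ _ => true
  | Seq c1 c2 | If _ c1 c2 => straight c1 && straight c2
  | While _ _ => false
  end.

Fixpoint ccost (c : cmd) : nat :=
  match c with
  | Skip | While _ _ => 1
  | NStore _ e1 e2 => (ncost e1 + ncost e2).+1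
  | RStore _ e1 e2 => (ncost e1 + rcost e2).+1
  | Seq c1 c2 => ccost c1 + ccost c2
  | If b c1 c2 => (bcost b + (ccost c1 + ccost c2)).+1
  end.

(** The arrays that a program can change. All others keep their contents, which
    is the frame condition used throughout. *)
Fixpoint iwrites (c : cmd) : seq nat :=
  match c with
  | Skip | RStore _ _ _ => [::]
  | NStore a _ _ => [:: a]
  | Seq c1 c2 | If _ c1 c2 => iwrites c1 ++ iwrites c2
  | While _ c1 => iwrites c1
  end.

Fixpoint rwrites (c : cmd) : seq nat :=
  match c with
  | Skip | NStore _ _ _ => [::]
  | RStore a _ _ => [:: a]
  | Seq c1 c2 | If _ c1 c2 => rwrites c1 ++ rwrites c2
  | While _ c1 => rwrites c1
  end.

Definition var a := NLoad a (NConst 0).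
Definition set_var a e := NStore a (NConst 0) e.

(** The bound [e] is evaluated again before every round. *)
Definition For a e body :=
  Seq (set_var a (NConst 0))
      (While (BNLt (var a) e)
             (Seq body (set_var a (NAdd (var a) (NConst 1))))).

Section Logic.
Variable R : realType.
Implicit Types (st : state R) (c : cmd) (a i : nat).

Fixpoint ceval c st : state R :=
  match c with
  | Skip | While _ _ => st
  | NStore a e1 e2 =>
      State (update (imem st) a (neval st e1) (neval st e2)) (rmem st)
  | RStore a e1 e2 =>
      State (imem st) (update (rmem st) a (neval st e1) (reval st e2))
  | Seq c1 c2 => ceval c2 (ceval c1 st)
  | If b c1 c2 => if beval st b then ceval c1 st else ceval c2 st
  end.

Lemma cevalS c1 c2 st : ceval (Seq c1 c2) st = ceval c2 (ceval c1 st).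
Proof. by []. Qed.

Definition frame c st st' : Prop :=
  (forall a i, a \notin iwrites c -> imem st' a i = imem st a i) /\
  (forall a i, a \notin rwrites c -> rmem st' a i = rmem st a i).

Lemma frame_trans c st1 st2 st3 :
  frame c st1 st2 -> frame c st2 st3 -> frame c st1 st3.
Proof.
move=> [h1 h2] [k1 k2]; split=> a i ha; first by rewrite k1 // h1.
by rewrite k2 // h2.
Qed.

Lemma frame_sub c1 c2 st st' :
  {subset iwrites c1 <= iwrites c2} -> {subset rwrites c1 <= rwrites c2} ->
  frame c1 st st' -> frame c2 st st'.
Proof.
move=> s1 s2 [h1 h2]; split=> a i ha; first by rewrite h1 //; apply: contra ha; apply: s1.
by rewrite h2 //; apply: contra ha; apply: s2.
Qed.

Lemma exec_frame c st t st' : exec c st t st' -> frame c st st'.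
Proof.
elim=> {c st t st'} //.
- move=> st a e1 e2; split=> //= b i; rewrite inE => /negPf hb.
  by rewrite /update hb.
- move=> st a e1 e2; split=> //= b i; rewrite inE => /negPf hb.
  by rewrite /update hb.
- move=> c1 c2 st t1 st1 t2 st2 _ F1 _ F2; apply: (@frame_trans _ _ st1).
    by apply: frame_sub F1 => b /= hb; rewrite mem_cat hb.
  by apply: frame_sub F2 => b /= hb; rewrite mem_cat hb orbT.
- move=> b c1 c2 st t st' _; apply: frame_sub => x /=;
  by case: beval => hx; rewrite mem_cat hx ?orbT.
- move=> b c st t1 st1 t2 st2 _ _ F1 _ F2; apply: (@frame_trans _ _ st1) F2.
  exact: frame_sub F1.
Qed.

(** Total correctness within a time bound. *)
Definition runs c st (T : nat) (Q : state R -> Prop) : Prop :=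
  exists t st', [/\ exec c st t st', (t <= T)%N & Q st'].

Lemma runs_frame c st T Q :
  runs c st T Q -> runs c st T (fun st' => Q st' /\ frame c st st').
Proof.
move=> [t [st' [E lt q]]]; exists t, st'; split=> //; split=> //.
exact: exec_frame E.
Qed.

Lemma runs_weaken c st (T T' : nat) (Q Q' : state R -> Prop) :
  runs c st T Q -> (T <= T')%N -> (forall st', Q st' -> Q' st') ->
  runs c st T' Q'.
Proof.
move=> [t [st' [E lt q]]] hT hQ; exists t, st'; split=> //; last exact: hQ.
exact: leq_trans hT.
Qed.

Lemma runs_seq c1 c2 st T1 T2 Q1 Q2 :
  runs c1 st T1 Q1 ->
  (forall st1, Q1 st1 -> frame c1 st st1 -> runs c2 st1 T2 Q2) ->
  runs (Seq c1 c2) st (T1 + T2) Q2.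
Proof.
move=> [t1 [st1 [E1 l1 q1]]] /(_ _ q1 (exec_frame E1)) [t2 [st2 [E2 l2 q2]]].
exists (t1 + t2)%N, st2; split=> //; last exact: leq_add.
exact: ExecSeq E1 E2.
Qed.

Lemma exec_straight c st : straight c ->
  exists2 t, exec c st t (ceval c st) & (t <= ccost c)%N.
Proof.
elim: c st => //=.
- by move=> st _; exists 1%N => //; constructor.
- by move=> a e1 e2 st _; eexists; [constructor | apply: leqnn].
- by move=> a e1 e2 st _; eexists; [constructor | apply: leqnn].
- move=> c1 IH1 c2 IH2 st /andP[s1 s2].
  have [t1 E1 l1] := IH1 st s1; have [t2 E2 l2] := IH2 (ceval c1 st) s2.
  by exists (t1 + t2)%N; [apply: ExecSeq E1 E2 | apply: leq_add].
- move=> b c1 IH1 c2 IH2 st /andP[s1 s2].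
  have [t1 E1 l1] := IH1 st s1; have [t2 E2 l2] := IH2 st s2.
  exists (bcost b + if beval st b then t1 else t2).+1.
    by apply: ExecIf; case: beval.
  by rewrite ltnS leq_add2l; case: beval; lia.
Qed.

Lemma runs_straight c st (Q : state R -> Prop) :
  straight c -> Q (ceval c st) -> runs c st (ccost c) Q.
Proof.
by move=> /(exec_straight st)[t E l] q; exists t, (ceval c st); split.
Qed.

Lemma runs_straight_seq c1 c2 st T2 T Q :
  straight c1 -> (ccost c1 + T2 <= T)%N ->
  (frame c1 st (ceval c1 st) -> runs c2 (ceval c1 st) T2 Q) ->
  runs (Seq c1 c2) st T Q.
Proof.
move=> s1 hT h2.
have h1 : runs c1 st (ccost c1) (eq (ceval c1 st)) by apply: runs_straight.
apply: (runs_weaken (runs_seq h1 (T2 := T2) (Q2 := Q) _)) => //.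
by move=> _ <-.
Qed.

(** The measure [mu] decreases in each round, so it bounds the number of rounds
    and gives termination and the running time at once. *)
Lemma runs_while b c st0 (cc : nat) (I : state R -> Prop)
    (mu : state R -> nat) :
  I st0 ->
  (forall st, frame c st0 st -> I st -> beval st b ->
     runs c st cc (fun st' => I st' /\ (mu st' < mu st)%N)) ->
  runs (While b c) st0 ((mu st0).+1 * (bcost b + cc).+1)
    (fun st => I st /\ ~~ beval st b).
Proof.
move=> I0 step.
suff H k st : (mu st <= k)%N -> frame c st0 st -> I st ->
    runs (While b c) st (k.+1 * (bcost b + cc).+1)
      (fun st' => I st' /\ ~~ beval st' b) by exact: H.
elim: k st => [|k IHk] st hmu F Ist; case: (boolP (beval st b)) => hb.
- by have [t [st1 [_ _ [_]]]] := step st F Ist hb; lia.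
- exists (bcost b).+1, st; split=> //; first by constructor.
  by rewrite mul1n ltnS leq_addr.
- have [t1 [st1 [E1 l1 [I1 m1]]]] := step st F Ist hb.
  have [||t2 [st2 [E2 l2 q2]]] := IHk st1 _ _ I1.
  + lia.
  + exact: frame_trans F (exec_frame E1).
  exists (bcost b + t1 + t2).+1, st2; split=> //.
    exact: ExecWhileTrue E1 E2.
  by rewrite mulSn; lia.
- exists (bcost b).+1, st; split=> //; first by constructor.
  by rewrite mulSn; lia.
Qed.

(** [I i.+1] is asked of the memory whose counter already holds [i.+1]; if [I]
    does not read the counter, it holds there by computation as soon as it holds
    after the body. *)
Lemma runs_for a e body st0 n (cc : nat) (I : nat -> state R -> Prop) :
  a \notin iwrites body ->
  (forall st, frame (For a e body) st0 st -> neval st e = n) ->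
  I 0%N (ceval (set_var a (NConst 0)) st0) ->
  (forall i st, (i < n)%N -> frame (For a e body) st0 st ->
     imem st a 0 = i -> I i st ->
     runs body st cc (fun st' =>
       I i.+1 (ceval (set_var a (NConst i.+1)) st'))) ->
  runs (For a e body) st0 (n.+1 * (cc + ncost e + 13)) (I n).
Proof.
move=> ha he I0 step.
set s1 := ceval (set_var a (NConst 0)) st0 in I0.
have E1 : exec (set_var a (NConst 0)) st0 3 s1 by constructor.
pose J st := (imem st a 0 <= n)%N /\ I (imem st a 0) st.
have J0 : J s1 by rewrite /J /= /update !eqxx.
have F1 : frame (For a e body) st0 s1.
  by apply: (frame_sub _ _ (exec_frame E1)) => x //=; rewrite !inE => ->.
have [|t [st [E lt [[hn Ist] hb]]]] := @runs_while (BNLt (var a) e)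
    (Seq body (set_var a (NAdd (var a) (NConst 1)))) s1 (cc + 6)%N J
    (fun st => n - imem st a 0)%N J0.
- move=> st F [hn Ist] /= hb.
  have Fs : frame (For a e body) st0 st.
    apply: frame_trans F1 _.
    by apply: frame_sub F => x hx; rewrite ?inE ?hx ?orbT //=.
  have lin : (imem st a 0 < n)%N by rewrite (he _ Fs) in hb.
  apply: (runs_seq (T1 := cc) (T2 := 6)); first exact: (step _ _ lin Fs erefl Ist).
  move=> st1 q Fb.
  have ea : imem st1 a 0 = imem st a 0 by case: Fb => Fb _; rewrite Fb.
  apply: (@runs_straight (set_var a (NAdd (var a) (NConst 1)))) => //=.
  rewrite /J /= ea.
  have -> : forall m, update m a 0 (imem st a 0 + 1)%N a 0 = (imem st a 0).+1.
    by move=> m; rewrite /update !eqxx addn1.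
  by split; [split=> //; move: q; rewrite /= addn1 | lia].
exists (3 + t)%N, st; split; first exact: ExecSeq E1 E.
  move: lt; rewrite /= {1}/update !eqxx subn0 => lt.
  apply: leq_trans (leq_add (leqnn 3) lt) _. nia.
have Fs : frame (For a e body) st0 st.
  apply: frame_trans F1 _.
  by apply: frame_sub (exec_frame E) => x hx; rewrite ?inE ?hx ?orbT //=.
move: hb; rewrite /= (he _ Fs) -leqNgt => hb.
by have -> : n = imem st a 0 by apply/eqP; rewrite eqn_leq hb hn.
Qed.

End Logic.

(** * The program *)

Notation "c1 ;; c2" := (Seq c1 c2) (at level 90, right associativity).

(* Integer variables, stored in cell 0. The number [vN] of columns counts an
   extra last column, to which rows with fewer than two entries refer. The
   search uses [vroot] (next root to try), the ends [vqh] and [vqt] of the queue,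
   the column [vu] being expanded, and the next half-edge [ve] of [vu] plus one.
   Merging relabels the component [vfrom] as [vto]. *)
Notation vN := 10%N.
Notation vNM := 11%N.
Notation vr := 12%N.
Notation vt := 13%N.
Notation vroot := 14%N.
Notation vqh := 15%N.
Notation vqt := 16%N.
Notation vu := 17%N.
Notation ve := 18%N.
Notation vacc := 19%N.
Notation vi := 31%N.
Notation vni := 32%N.
Notation va := 33%N.
Notation vb := 34%N.
Notation vpos := 35%N.
Notation vfrom := 36%N.
Notation vto := 37%N.
Notation vj := 38%N.
Notation vs := 39%N.
Notation vra := 40%N.
Notation vrb := 42%N.

(* Integer arrays: the two columns of a row ([aC1], [aC2]); the rows of K_m
   ([aMARK]); the half-edges of the search graph ([aSRC], [aTGT]) in linked lists
   ([aHEAD], [aNEXT]); component labels ([aLAB]), the queue ([aQ]), contradictory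
   components ([aBAD]); where the output and the weights of stage i begin
   ([aOFFD], [aOFFW]). *)
Notation aC1 := 20%N.
Notation aC2 := 21%N.
Notation aMARK := 22%N.
Notation aHEAD := 23%N.
Notation aNEXT := 24%N.
Notation aTGT := 25%N.
Notation aLAB := 26%N.
Notation aQ := 27%N.
Notation aBAD := 28%N.
Notation aOFFD := 29%N.
Notation aOFFW := 30%N.
Notation aSRC := 41%N.

(* Real arrays and variables: the two entries of a row, the ratio imposed by a
   half-edge, the potential, the squared norm of the potential on each
   component, an accumulator, and the factor used in merging. *)
Notation rV1 := 10%N.
Notation rV2 := 11%N.
Notation rRAT := 12%N.
Notation rX := 13%N.
Notation rNRM := 14%N.
Notation racc := 20%N.
Notation rfac := 21%N.

Definition rvar a := RLoad a (NConst 0).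
Definition size_m := NLoad 0 (NConst 0).
Definition size_n0 := NLoad 0 (NConst 1).
Definition size_nL := NLoad 0 (NConst 2).
Definition size_nL1 := NLoad 0 (NConst 3).
Definition succ e := NAdd e (NConst 1).

Definition slot1 r := RMul (RLoad rV1 r) (RLoad rX (NLoad aC1 r)).
Definition slot2 r := RMul (RLoad rV2 r) (RLoad rX (NLoad aC2 r)).
Definition rnonzero e := BNot (BREq e (RConst 0)).

Definition load_row :=
  NStore aC1 (var vr) size_nL1 ;;
  NStore aC2 (var vr) size_nL1 ;;
  If (BNLt (NLoad 1 (var vr)) (NLoad 1 (succ (var vr))))
     (NStore aC1 (var vr) (NLoad 2 (NLoad 1 (var vr))) ;;
      RStore rV1 (var vr) (RLoad 0 (NLoad 1 (var vr)))) Skip ;;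
  If (BNLt (succ (NLoad 1 (var vr))) (NLoad 1 (succ (var vr))))
     (NStore aC2 (var vr) (NLoad 2 (succ (NLoad 1 (var vr)))) ;;
      RStore rV2 (var vr) (RLoad 0 (succ (NLoad 1 (var vr))))) Skip.

Definition load_rows := For vr size_nL load_row.

Definition mark_rows :=
  set_var vNM (NAdd size_m size_n0) ;;
  For vj (var vNM) (NStore aMARK (NLoad 3 (var vj)) (NConst 1)).

Definition unmarked r := BNEq (NLoad aMARK r) (NConst 0).

Definition half_edge_pair :=
  let d := NAdd (var vr) (var vr) in
  If (BAnd (unmarked (var vr))
       (BAnd (rnonzero (RLoad rV1 (var vr))) (rnonzero (RLoad rV2 (var vr)))))
     (NStore aSRC d (succ (NLoad aC1 (var vr))) ;;
      NStore aTGT d (NLoad aC2 (var vr)) ;;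
      RStore rRAT d (RSub (RConst 0)
        (RDiv (RLoad rV1 (var vr)) (RLoad rV2 (var vr)))) ;;
      NStore aSRC (succ d) (succ (NLoad aC2 (var vr))) ;;
      NStore aTGT (succ d) (NLoad aC1 (var vr)) ;;
      RStore rRAT (succ d) (RSub (RConst 0)
        (RDiv (RLoad rV2 (var vr)) (RLoad rV1 (var vr)))))
     Skip.

Definition half_edges := For vr size_nL half_edge_pair.

Definition link_half_edges :=
  For vj (NAdd size_nL size_nL)
    (NStore aNEXT (var vj) (NLoad aHEAD (NLoad aSRC (var vj))) ;;
     NStore aHEAD (NLoad aSRC (var vj)) (succ (var vj))).

Definition push t :=
  NStore aQ (var vqt) t ;;
  set_var vqt (succ (var vqt)).

(** One round follows a half-edge of the current column, or else takes the next
    column off the queue, or else tries the next root. With a single loop there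
    is a single invariant and no nested measure. *)
Definition search_step :=
  let g := NSub (var ve) (NConst 1) in
  If (BNot (BNEq (var ve) (NConst 0)))
     (set_var vt (NLoad aTGT g) ;;
      If (BNEq (NLoad aLAB (var vt)) (NConst 0))
         (NStore aLAB (var vt) (NLoad aLAB (var vu)) ;;
          RStore rX (var vt) (RMul (RLoad rRAT g) (RLoad rX (var vu))) ;;
          push (var vt)) Skip ;;
      set_var ve (NLoad aNEXT g))
     (If (BNLt (var vqh) (var vqt))
         (set_var vu (NLoad aQ (var vqh)) ;;
          set_var vqh (succ (var vqh)) ;;
          set_var ve (NLoad aHEAD (succ (var vu))))
         (If (BNEq (NLoad aLAB (var vroot)) (NConst 0))
             (NStore aLAB (var vroot) (succ (var vroot)) ;;
              RStore rX (var vroot) (RConst 1) ;;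
              push (var vroot)) Skip ;;
          set_var vroot (succ (var vroot)))).

Definition search :=
  While (BNot (BAnd (BNEq (var ve) (NConst 0))
           (BAnd (BNEq (var vqh) (var vqt)) (BNEq (var vroot) (var vN)))))
    search_step.

(** A row violated by the potentials shows that the component containing its
    columns carries only the zero chain. *)
Definition check_rows :=
  For vr size_nL
    (If (BAnd (unmarked (var vr))
              (rnonzero (RAdd (slot1 (var vr)) (slot2 (var vr)))))
        (If (rnonzero (RLoad rV1 (var vr)))
            (NStore aBAD (NLoad aLAB (NLoad aC1 (var vr))) (NConst 1))
            (NStore aBAD (NLoad aLAB (NLoad aC2 (var vr))) (NConst 1)))
        Skip).

Definition kill_bad :=
  For vt (var vN)
    (If (BNEq (NLoad aBAD (NLoad aLAB (var vt))) (NConst 0)) Skip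
        (RStore rX (var vt) (RConst 0))).

(** There is no multiplication of integers, so the squares are accumulated by
    repeated addition; this costs one addition for each row of an output. *)
Definition offsets :=
  For vi (succ size_m)
    (NStore aOFFD (var vi) (var vpos) ;;
     NStore aOFFW (var vi) (var vacc) ;;
     set_var vni (NAdd size_n0 (var vi)) ;;
     For vj (var vni) (set_var vpos (NAdd (var vpos) (var vni))) ;;
     set_var vacc (NAdd (var vacc) (var vni))).

Definition clear_norms :=
  For vt (succ (var vN)) (RStore rNRM (var vt) (RConst 0)).

Definition add_norms :=
  For vt (var vN)
    (RStore rNRM (NLoad aLAB (var vt))
       (RAdd (RLoad rNRM (NLoad aLAB (var vt)))
          (RDiv (RMul (RLoad rX (var vt)) (RLoad rX (var vt)))
                (RLoad 2 (var vt))))).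

Definition compute_norms := clear_norms ;; add_norms.

Definition add_term cp cq (sp sq : nexp -> rexp) :=
  If (BNEq (NLoad aLAB (NLoad cp (var vra))) (NLoad aLAB (NLoad cq (var vrb))))
     (RStore racc (NConst 0)
        (RAdd (rvar racc)
           (RDiv (RMul (sp (var vra)) (sq (var vrb)))
                 (RLoad rNRM (NLoad aLAB (NLoad cp (var vra)))))))
     Skip.

Definition emit_entry :=
  set_var vrb (NLoad 3 (var vb)) ;;
  RStore racc (NConst 0) (RConst 0) ;;
  add_term aC1 aC1 slot1 slot1 ;;
  add_term aC1 aC2 slot1 slot2 ;;
  add_term aC2 aC1 slot2 slot1 ;;
  add_term aC2 aC2 slot2 slot2 ;;
  RStore 3 (var vpos)
    (RDiv (rvar racc) (RLoad 1 (NAdd (NLoad aOFFW (var vi)) (var vb)))) ;;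
  set_var vpos (succ (var vpos)).

Definition emit_row :=
  set_var vra (NLoad 3 (var va)) ;;
  For vb (var vni) emit_entry.

Definition emit :=
  set_var vpos (NLoad aOFFD (var vi)) ;;
  For va (var vni) emit_row.

(** The default is to rescale the component of the first column by 1 or 0, as
    the new constraint holds on it or not. When the columns lie in different
    components and the second value is nonzero, the second component is rescaled
    instead and joined to the first; if the first value vanishes, the factor is 0
    and this annihilates the second component. *)
Definition merge_setup :=
  set_var vrb (NLoad 3 (NSub (var vni) (NConst 1))) ;;
  set_var vfrom (NLoad aLAB (NLoad aC1 (var vrb))) ;;
  set_var vto (var vfrom) ;;
  If (BREq (RAdd (slot1 (var vrb)) (slot2 (var vrb))) (RConst 0))
     (RStore rfac (NConst 0) (RConst 1))
     (RStore rfac (NConst 0) (RConst 0)) ;;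
  If (BAnd (BNot (BNEq (var vfrom) (NLoad aLAB (NLoad aC2 (var vrb)))))
           (rnonzero (slot2 (var vrb))))
     (set_var vfrom (NLoad aLAB (NLoad aC2 (var vrb))) ;;
      RStore rfac (NConst 0)
        (RSub (RConst 0) (RDiv (slot1 (var vrb)) (slot2 (var vrb))))) Skip.

Definition merge_labels :=
  merge_setup ;;
  For vt (var vN)
    (If (BNEq (NLoad aLAB (var vt)) (var vfrom))
        (RStore rX (var vt) (RMul (RLoad rX (var vt)) (rvar rfac)) ;;
         NStore aLAB (var vt) (var vto)) Skip).

Definition stage :=
  set_var vi (NSub size_m (var vs)) ;;
  set_var vni (NAdd size_n0 (var vi)) ;;
  compute_norms ;; emit ;; merge_labels.

Definition stages := For vs (succ size_m) stage.

Definition laplacians_prog :=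
  set_var vN (succ size_nL1) ;;
  load_rows ;; mark_rows ;; half_edges ;; link_half_edges ;;
  search ;; check_rows ;; kill_bad ;; offsets ;; stages.

(** * Graph search *)

Definition upd (T : Type) (f : nat -> T) i v := fun j => if j == i then v else f j.

Lemma upd_eq (T : Type) (f : nat -> T) i v : upd f i v i = v.
Proof. by rewrite /upd eqxx. Qed.

Lemma upd_neq (T : Type) (f : nat -> T) i v j : j != i -> upd f i v j = f j.
Proof. by rewrite /upd => /negPf->. Qed.

Lemma count_lt (T : eqType) (P' P : pred T) (s : seq T) x :
  subpred P' P -> x \in s -> P x -> ~~ P' x -> (count P' s < count P s)%N.
Proof.
move=> sub + px /negPf p'x; elim: s => //= y s IH; rewrite inE.
have le := sub_count sub s; case/predU1P=> [<-|/IH lt]; first by rewrite px p'x.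
by apply: leq_ltn_trans (_ : _ <= P y + count P' s)%N _; rewrite ?leq_add2r ?ltn_add2l //;
  case p'y: (P' y) => //; rewrite (sub _ p'y).
Qed.

(** One more than the last half-edge below [G] with source label [s], or 0. The
    linked lists of half-edges are described by this function: [aHEAD] and
    [aNEXT] hold its values, and traversal visits half-edges in decreasing
    order. *)
Fixpoint prv (src : nat -> nat) (s G : nat) : nat :=
  if G is G'.+1 then if src G' == s then G else prv src s G' else 0.

Lemma prv_le src s G : (prv src s G <= G)%N.
Proof. by elim: G => //= G IH; case: ifP => // _; apply: leq_trans IH _. Qed.

Lemma prv_src src s G : prv src s G != 0%N -> src (prv src s G).-1 = s.
Proof. by elim: G => //= G IH; case: ifP => // /eqP. Qed.

Lemma prv_last src s G g : (prv src s G <= g)%N -> (g < G)%N -> src g != s.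
Proof.
elim: G => //= G IH; case: ifP => [_|/negbT ne le lt]; first by lia.
by case: (ltngtP g G) => [lt'|lt'|->] //; [apply: IH | lia].
Qed.

Section Search.
Variables (R : realType) (n H : nat).
Variables (src tgt : nat -> nat) (rat : nat -> R).

(** Chains satisfying the two-term constraints that the half-edges encode. *)
Definition respects (c : nat -> R) : Prop :=
  forall g, (g < H)%N -> src g != 0%N -> c (tgt g) = rat g * c (src g).-1.

Hypothesis src_le : forall g, (g < H)%N -> (src g <= n)%N.
Hypothesis tgt_lt : forall g, (g < H)%N -> src g != 0%N -> (tgt g < n)%N.
Hypothesis reversible : forall g, (g < H)%N -> src g != 0%N ->
  exists g', [/\ (g' < H)%N, src g' = (tgt g).+1 & tgt g' = (src g).-1].

Definition queue (q : nat -> nat) l := [seq q j | j <- iota 0 l].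

(** The half-edge [g] leaves a dequeued column and has been followed: those of
    the current column [u] that are still to come are the ones below [e]. *)
Definition handled (q : nat -> nat) (e h u g : nat) : bool :=
  ((src g).-1 \in queue q h) && ~~ ((src g == u.+1) && (g < e)%N).

(** The ghost parameter [cl] is the label of the component under construction:
    all columns waiting in the queue carry it. *)
Record search_inv (lab : nat -> nat) (x : nat -> R) (q : nat -> nat)
    (e h l root u cl : nat) : Prop := SearchInv {
  inv_root : (root <= n)%N;
  inv_h : (h <= l)%N;
  inv_cl : (cl <= n)%N;
  inv_uniq : uniq (queue q l);
  inv_queue : forall t, (t \in queue q l) = (t < n)%N && (lab t != 0%N);
  inv_lab_le : forall t, (t < n)%N -> (lab t <= n)%N;
  inv_x : forall t c, (t < n)%N -> lab t != 0%N -> respects c ->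
    c t = c (lab t).-1 * x t;
  inv_labelled : forall t, (t < root)%N -> lab t != 0%N;
  inv_e : (e <= H)%N;
  inv_edge : e != 0%N -> [/\ (0 < h)%N, u = q h.-1, src e.-1 = u.+1 & lab u = cl];
  inv_handled : forall g, (g < H)%N -> src g != 0%N -> handled q e h u g ->
    lab (tgt g) = lab (src g).-1;
  inv_front : forall j, (h <= j)%N -> (j < l)%N -> lab (q j) = cl
}.

Definition pending q e h u :=
  count (fun g => (src g != 0%N) && ~~ handled q e h u g) (iota 0 H).

Lemma mem_queue q l j : (j < l)%N -> q j \in queue q l.
Proof. by move=> jl; apply: map_f; rewrite mem_iota. Qed.

Lemma queueP q l t : reflect (exists2 j, (j < l)%N & q j = t) (t \in queue q l).
Proof.
apply: (iffP mapP) => [[j] | [j jl <-]]; last by exists j => //; rewrite mem_iota.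
by rewrite mem_iota => /andP[_ jl] ->; exists j.
Qed.

Lemma queueS q l : queue q l.+1 = rcons (queue q l) (q l).
Proof. by rewrite /queue -addn1 iotaD map_cat cats1. Qed.

Lemma queue_sub q h l : (h <= l)%N -> {subset queue q h <= queue q l}.
Proof.
move=> hl t /queueP[j jh <-]; apply: mem_queue; exact: leq_trans hl.
Qed.

Lemma queue_upd q l h t : (h <= l)%N -> queue (upd q l t) h = queue q h.
Proof.
move=> hl; apply/eq_in_map => j; rewrite mem_iota => /andP[_ jh].
by rewrite upd_neq //; lia.
Qed.

Section Steps.
Variables (lab : nat -> nat) (x : nat -> R) (q : nat -> nat).
Variables (e h l root u cl : nat).
Hypothesis I : search_inv lab x q e h l root u cl.

Lemma queue_lt_n j : (j < l)%N -> (q j < n)%N && (lab (q j) != 0%N).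
Proof. by move=> jl; rewrite -(inv_queue I) mem_queue. Qed.

Lemma tail_le : (l <= n)%N.
Proof.
have := @uniq_leq_size _ (queue q l) (iota 0 n) (inv_uniq I).
rewrite size_map !size_iota; apply => t.
by rewrite (inv_queue I) mem_iota => /andP[].
Qed.

(** Labelling a new column and appending it to the queue. *)
Lemma inv_push t xi : (t < n)%N -> lab t = 0%N -> (0 < cl)%N ->
  (forall c, respects c -> c t = c cl.-1 * xi) ->
  search_inv (upd lab t cl) (upd x t xi) (upd q l t) e h l.+1 root u cl.
Proof.
move=> tn t0 cl0 hc.
have keep s : lab s != 0%N -> upd lab t cl s = lab s.
  by move=> s0; rewrite upd_neq //; apply: contraNneq s0 => ->; rewrite t0.
have hl := inv_h I.
split.
- exact: (inv_root I).
- exact: leqW.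
- exact: (inv_cl I).
- rewrite queueS queue_upd // upd_eq rcons_uniq (inv_uniq I) andbT.
  by rewrite (inv_queue I) t0 andbF.
- move=> s; rewrite queueS queue_upd // upd_eq mem_rcons inE (inv_queue I) /upd.
  by case: (eqVneq s t) => [->|_] //=; rewrite tn -lt0n cl0.
- move=> s sn; rewrite /upd; case: (s == t); first exact: (inv_cl I).
  exact: (inv_lab_le I sn).
- move=> s c sn; rewrite /upd; case: (eqVneq s t) => [-> _|_]; first exact: hc.
  exact: (inv_x I).
- move=> s /(inv_labelled I) s0; by rewrite keep.
- exact: (inv_e I).
- move=> e0; have [h0 eu se lu] := inv_edge I e0; split=> //.
    by rewrite upd_neq //; lia.
  by rewrite keep // eu; have/andP[] := @queue_lt_n h.-1 ltac:(lia).
- move=> g gH sg; rewrite /handled queue_upd // => hg.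
  have hs : lab (src g).-1 != 0%N.
    case/andP: hg => /(queue_sub hl); rewrite (inv_queue I) => /andP[_ ->] //.
  have e1 := inv_handled I gH sg hg.
  by rewrite !keep // e1.
- move=> j hj; rewrite ltnS leq_eqVlt => /orP[/eqP->|jl]; first by rewrite !upd_eq.
  rewrite [upd q l t j]upd_neq; last by lia.
  rewrite keep; first exact: (inv_front I hj jl).
  by case/andP: (queue_lt_n jl).
Qed.

Lemma pending_upd t : pending (upd q l t) e h u = pending q e h u.
Proof. by apply: eq_count => g; rewrite /handled queue_upd // (inv_h I). Qed.

(** An edge never leads to an older component: such a column would have been
    expanded completely, and the reversed half-edge would have labelled [u]
    then. *)
Lemma seen_label : e != 0%N -> lab (tgt e.-1) != 0%N -> lab (tgt e.-1) = cl.
Proof.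
move=> e0 t0; have [h0 eu se lu] := inv_edge I e0.
have eH : (e.-1 < H)%N by have := inv_e I; lia.
have s0 : src e.-1 != 0%N by rewrite se.
have tn := tgt_lt eH s0.
(* The column waits in the queue, or is [u] itself, or was dequeued before. *)
have : tgt e.-1 \in queue q l by rewrite (inv_queue I) tn.
case/queueP=> j jl ej.
case: (leqP h j) => hj; first by rewrite -ej (inv_front I).
case: (eqVneq j h.-1) => [ejh|nj]; first by rewrite -ej ejh -eu lu.
have [g' [g'H sg' tg']] := reversible eH s0.
have neu : tgt e.-1 != u.
  rewrite -ej eu; apply: contra nj => /eqP eq.
  have hl := inv_h I; have := inv_uniq I.
  move=> /(uniqP 0%N)/(_ j h.-1); rewrite !inE !size_map size_iota => inj.
  apply/eqP; apply: inj; [lia|lia|].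
  by rewrite !(nth_map 0%N) ?size_iota ?nth_iota ?add0n //; lia.
have hg' : handled q e h u g'.
  apply/andP; split; last by rewrite sg' eqSS (negPf neu).
  by rewrite sg' /= -ej mem_queue.
have := inv_handled I g'H _ hg'; rewrite sg' tg' => /(_ isT) /= <-.
by rewrite se.
Qed.

Lemma inv_next : e != 0%N -> lab (tgt e.-1) = cl ->
  search_inv lab x q (prv src u.+1 e.-1) h l root u cl.
Proof.
move=> e0 te; have [h0 eu se lu] := inv_edge I e0.
have ple := prv_le src u.+1 e.-1.
case: (I) => *; split=> //.
- by have := inv_e I; lia.
- by move=> /prv_src.
- move=> g gH sg /andP[gq gp].
  case: (boolP (handled q e h u g)) => [hg|]; first exact: (inv_handled I gH sg hg).
  rewrite /handled gq /= negbK => /andP[/eqP su ge].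
  have -> : g = e.-1; last by rewrite te se.
  move: gp; rewrite su eqxx /= -leqNgt => gp.
  apply/eqP; apply: contraT => ne.
  by have := prv_last gp (ltac:(lia) : (g < e.-1)%N); rewrite su eqxx.
Qed.

(** Moving to the next half-edge settles the current one, and no other was
    skipped; this pays for the round. *)
Lemma pending_next : e != 0%N ->
  (pending q (prv src u.+1 e.-1) h u < pending q e h u)%N.
Proof.
move=> e0; have [h0 eu se lu] := inv_edge I e0.
have ple := prv_le src u.+1 e.-1.
have eH : (e.-1 < H)%N by have := inv_e I; lia.
pose P g := (src g != 0%N) && ~~ handled q e h u g.
pose P' g := (src g != 0%N) && ~~ handled q (prv src u.+1 e.-1) h u g.
have sub : subpred P' P.
  move=> g /andP[g0]; rewrite /P g0 /= /handled; apply: contra.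
  by move=> /andP[-> /=]; apply: contra => /andP[-> /=]; lia.
apply: (count_lt sub (x := e.-1)); first by rewrite mem_iota.
- rewrite /P se /= /handled negb_and negbK se eqxx /= orbC.
  by rewrite prednK ?leqnn // lt0n.
- rewrite /P' /handled se eqxx /= -leqNgt ple negbK andbT.
  by rewrite eu mem_queue //; lia.
Qed.

Lemma inv_dequeue : e = 0%N -> (h < l)%N ->
  search_inv lab x q (prv src (q h).+1 H) h.+1 l root (q h) cl.
Proof.
move=> e0 hl; have /andP[qn ql] := queue_lt_n hl.
case: (I) => *; split=> //; first exact: prv_le.
- by move=> /prv_src ->; split=> //; apply: (inv_front I).
- move=> g gH sg; rewrite /handled queueS mem_rcons inE => /andP[].
  case/predU1P=> [su|gq _].
    have su' : src g = (q h).+1 by rewrite -su prednK // lt0n.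
    rewrite su' eqxx /= -leqNgt => /prv_last/(_ gH).
    by rewrite su' eqxx.
  by apply: (inv_handled I gH sg); rewrite /handled gq e0 ltn0 andbF.
- by move=> j hj jl; apply: (inv_front I) => //; lia.
Qed.

Lemma pending_dequeue : e = 0%N -> (h < l)%N ->
  (pending q (prv src (q h).+1 H) h.+1 (q h) <= pending q e h u)%N.
Proof.
move=> e0 hl; apply: sub_count => g /= /andP[-> /=]; apply: contra.
rewrite /handled e0 ltn0 andbF andbT queueS mem_rcons inE => gq.
rewrite gq orbT /=; apply/nandP; left; apply: contraTneq gq => ->.
suff : uniq (queue q h.+1) by rewrite queueS rcons_uniq => /andP[].
have := inv_uniq I.
by rewrite -{1}(subnKC hl) /queue iotaD map_cat cat_uniq => /andP[].
Qed.

Lemma inv_root_next : (root < n)%N -> lab root != 0%N ->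
  search_inv lab x q e h l root.+1 u cl.
Proof.
move=> rn r0; case: (I) => *; split=> // t; rewrite ltnS leq_eqVlt.
by case/predU1P=> [->|] //; apply: (inv_labelled I).
Qed.

(** With an empty queue no column waits for the current label, so a new
    component can begin. *)
Lemma inv_new_label cl' : e = 0%N -> h = l -> (cl' <= n)%N ->
  search_inv lab x q e h l root u cl'.
Proof.
move=> e0 hl cn; case: (I) => *; split=> //; first by rewrite e0.
by move=> j; rewrite hl; lia.
Qed.

Lemma search_done : e = 0%N -> h = l -> root = n ->
  (forall t, (t < n)%N -> (0 < lab t <= n)%N /\
     forall c, respects c -> c t = c (lab t).-1 * x t) /\
  (forall g, (g < H)%N -> src g != 0%N -> lab (tgt g) = lab (src g).-1).
Proof.
move=> e0 hl rn.
have l0 t : (t < n)%N -> lab t != 0%N by rewrite -rn; apply: (inv_labelled I).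
split=> [t tn|g gH sg].
  rewrite lt0n l0 // (inv_lab_le I tn); split=> // c.
  by apply: (inv_x I) => //; apply: l0.
apply: (inv_handled I gH sg); rewrite /handled e0 ltn0 andbF andbT hl.
have sn : ((src g).-1 < n)%N by have := src_le gH; lia.
by rewrite (inv_queue I) sn l0.
Qed.

End Steps.

Lemma inv_start lab x q u : (forall t, lab t = 0%N) ->
  search_inv lab x q 0 0 0 0 u 0.
Proof. by move=> l0; split=> //= t; rewrite l0 // in_nil andbF. Qed.

Definition searching (st : state R) : Prop := exists cl,
  search_inv (imem st aLAB) (rmem st rX) (imem st aQ) (imem st ve 0)
    (imem st vqh 0) (imem st vqt 0) (imem st vroot 0) (imem st vu 0) cl.

(** Each round tries a root, dequeues a column or settles a half-edge. *)
Definition search_left (st : state R) : nat :=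
  (n - imem st vroot 0) + (n - imem st vqh 0)
  + pending (imem st aQ) (imem st ve 0) (imem st vqh 0) (imem st vu 0).

Record search_input (st : state R) : Prop := SearchInput {
  in_N : imem st vN 0 = n;
  in_tgt : forall g, (g < H)%N -> src g != 0%N -> imem st aTGT g = tgt g;
  in_rat : forall g, (g < H)%N -> src g != 0%N -> rmem st rRAT g = rat g;
  in_next : forall g, (g < H)%N -> src g != 0%N ->
    imem st aNEXT g = prv src (src g) g;
  in_head : forall t, (t < n)%N -> imem st aHEAD t.+1 = prv src t.+1 H
}.

Lemma search_step_spec st : search_input st -> searching st ->
  beval st (BNot (BAnd (BNEq (var ve) (NConst 0))
           (BAnd (BNEq (var vqh) (var vqt)) (BNEq (var vroot) (var vN))))) ->
  searching (ceval search_step st) /\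
  (search_left (ceval search_step st) < search_left st)%N.
Proof.
move=> [iN it ir inx ih] [cl I] /= hb.
have eH := inv_e I; have hl := inv_h I; have rn := inv_root I.
have ln := tail_le I.
case: ifP => [/= e0|/negbFE/eqP e0].
  have [h0 eu se lu] := inv_edge I e0.
  have eH' : ((imem st ve 0).-1 < H)%N by lia.
  have se0 : src (imem st ve 0).-1 != 0%N by rewrite se.
  have tn := tgt_lt eH' se0.
  rewrite /update /= !subn1 it //.
  have su : src (imem st ve 0).-1 = (imem st vu 0).+1 by [].
  have pn := pending_next I e0.
  case: eqP => [t0|/eqP t0].
    have /andP[un ul] : (imem st vu 0 < n)%N && (imem st aLAB (imem st vu 0) != 0%N).
      by rewrite eu; apply: (queue_lt_n I); lia.
    have cl0 : (0 < cl)%N by rewrite -lu lt0n.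
    have hx c : respects c ->
        c (tgt (imem st ve 0).-1)
        = c cl.-1 * (rat (imem st ve 0).-1 * rmem st rX (imem st vu 0)).
      by move=> hc; rewrite (hc _ eH' se0) su -lu (inv_x I (c := c) un) // mulrCA.
    have I1 := inv_push I tn t0 cl0 hx.
    have I2 := inv_next I1 e0 (upd_eq _ _ _).
    split.
      exists cl; rewrite /= addn1 lu ir // inx // su.
      exact: I2.
    rewrite /search_left /= inx // su ltn_add2l.
    rewrite -(pending_upd I (tgt (imem st ve 0).-1)).
    exact: pending_next I1 e0.
  split.
    exists cl; rewrite /= inx // su; exact: (inv_next I e0 (seen_label I e0 t0)).
  by rewrite /search_left /= inx // su ltn_add2l.
case: ifP => [/= hlt|/negbT hle].
  have I1 := inv_dequeue I e0 hlt.
  have /andP[qn _] := queue_lt_n I hlt.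
  have pd := pending_dequeue I e0 hlt.
  rewrite /update /=; split.
    by exists cl; rewrite /= !addn1 ih.
  rewrite /search_left /= !addn1 ih //. 
  by apply: leq_ltn_trans (leq_add (leqnn _) pd) _; rewrite ltn_add2r; lia.
have hl' : imem st vqh 0 = imem st vqt 0 by apply/eqP; rewrite eqn_leq hl leqNgt.
have rn' : (imem st vroot 0 < n)%N.
  by move: hb; rewrite e0 hl' !eqxx iN /= ltn_neqAle rn => ->.
case: eqP => [r0|/eqP r0].
  have I1 := inv_new_label I e0 hl' rn'.
  have I2 := inv_push (xi := 1) I1 rn' r0 isT (fun c _ => esym (mulr1 _)).
  have I3 := inv_root_next I2 rn' ltac:(by rewrite upd_eq).
  rewrite /update /=; split.
    by exists (imem st vroot 0).+1; rewrite /= !addn1.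
  rewrite /search_left /= !addn1.
  have := pending_upd I (imem st vroot 0).
  by rewrite /upd => ->; rewrite ltn_add2r; lia.
have I1 := inv_root_next I rn' r0.
rewrite /update /=; split; first by exists cl; rewrite /= addn1.
by rewrite /search_left /= addn1 ltn_add2r; lia.
Qed.

(** The search yields potentials that determine every constrained chain from
    its values at the roots (a root carries its own number plus one as label),
    and labels that are constant along edges. *)
Lemma search_spec (st0 : state R) :
  search_input st0 -> (forall t, imem st0 aLAB t = 0%N) ->
  [/\ imem st0 ve 0 = 0%N, imem st0 vqh 0 = 0%N, imem st0 vqt 0 = 0%N &
      imem st0 vroot 0 = 0%N] ->
  runs search st0 ((n + n + H).+1 * (ccost search_step + 20))
    (fun st =>
       (forall t, (t < n)%N -> (0 < imem st aLAB t <= n)%N /\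
          forall c, respects c ->
            c t = c (imem st aLAB t).-1 * rmem st rX t) /\
       (forall g, (g < H)%N -> src g != 0%N ->
          imem st aLAB (tgt g) = imem st aLAB (src g).-1)).
Proof.
move=> inp l0 [e0 h0 q0 r0].
have S0 : searching st0 by exists 0%N; rewrite e0 h0 q0 r0; apply: inv_start.
have keep st : frame search_step st0 st -> search_input st.
  case: inp => i1 i2 i3 i4 i5 [F1 F2].
  by split=> *; rewrite ?F1 ?F2 //; auto.
apply: (runs_weaken (runs_frame (runs_while (cc := ccost search_step) (mu := search_left) S0 _))).
- move=> st F S hb; apply: runs_straight => //.
  exact: search_step_spec (keep _ F) S hb.
- move: (ccost search_step) => k; apply: leq_mul; last by rewrite [bcost _]/=; lia.
  rewrite ltnS /search_left h0 r0 !subn0 leq_add2l.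
  by apply: leq_trans (count_size _ _) _; rewrite size_iota.
- move=> st [[[cl I] hb] F]; move: hb; rewrite /= negbK.
  rewrite (in_N (keep _ F)) => /and3P[/eqP e1 /eqP hl /eqP rn].
  exact: (search_done I).
Qed.

End Search.

(** * Kernels of sparse constraints *)

Section Kernel.
Variables (R : realType) (n nL : nat) (c1 c2 : nat -> nat) (v1 v2 : nat -> R).
Implicit Types (S : pred nat) (c x y : nat -> R) (lab : nat -> nat).

Definition row_val c r := v1 r * c (c1 r) + v2 r * c (c2 r).

Definition ker S c : Prop := forall r, (r < nL)%N -> S r -> row_val c r = 0.

(** The chains killed by the rows in [S] are those that are proportional to [x]
    on each class of [lab]. *)
Definition param S lab x : Prop := forall c,
  ker S c <-> exists y, forall t, (t < n)%N -> c t = y (lab t) * x t.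

Hypothesis c1_lt : forall r, (r < nL)%N -> (c1 r < n)%N.
Hypothesis c2_lt : forall r, (r < nL)%N -> (c2 r < n)%N.

Lemma eq_param S S' lab lab' x x' :
  (forall r, (r < nL)%N -> S r = S' r) ->
  (forall t, (t < n)%N -> lab t = lab' t) ->
  (forall t, (t < n)%N -> x t = x' t) ->
  param S lab x -> param S' lab' x'.
Proof.
move=> hS hl hx P c; split=> [hc | [y hy]].
  have [|y hy] := (P c).1; first by move=> r rn Sr; apply: hc; rewrite -?hS.
  by exists y => t tn; rewrite hy // hl // hx.
move=> r rn Sr; apply: (P c).2; rewrite ?hS //.
by exists y => t tn; rewrite hy // hl // hx.
Qed.

Definition joins lab x r :=
  (lab (c1 r) != lab (c2 r)) && (v2 r * x (c2 r) != 0).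

Definition merge_from lab x r :=
  if joins lab x r then lab (c2 r) else lab (c1 r).

Definition merge_factor lab x r : R :=
  if joins lab x r then 0 - v1 r * x (c1 r) / (v2 r * x (c2 r))
  else if row_val x r == 0 then 1 else 0.

(** Substituting [c t = y (lab t) * x t] into row [r] leaves one linear relation
    between the two numbers [y] at the labels of its columns; solving it for
    one of them gives the new labels and potential. *)
Lemma param_merge S r lab x : (r < nL)%N -> param S lab x ->
  param (predU1 r S)
    (fun t => if lab t == merge_from lab x r then lab (c1 r) else lab t)
    (fun t => if lab t == merge_from lab x r then x t * merge_factor lab x r
              else x t).
Proof.
move=> rL P c.
have kerU : ker (predU1 r S) c <-> ker S c /\ row_val c r = 0.
  split=> [h|[h h0] s sL /predU1P[->|]] //; last exact: h.
  by split=> [s sL Ss|]; apply: h; rewrite //= ?eqxx ?Ss ?orbT.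
have val y : (forall t, (t < n)%N -> c t = y (lab t) * x t) ->
    row_val c r = y (lab (c1 r)) * (v1 r * x (c1 r))
                + y (lab (c2 r)) * (v2 r * x (c2 r)).
  by move=> hy; rewrite /row_val !hy ?c1_lt ?c2_lt //; ring.
set z1 := v1 r * x (c1 r) in val; set z2 := v2 r * x (c2 r) in val.
set l1 := lab (c1 r) in val *; set l2 := lab (c2 r) in val.
apply: (iff_trans kerU); rewrite P.
rewrite /merge_from /merge_factor /joins -/l1 -/l2 -/z1 -/z2.
have [/andP[nl nz]|] := boolP (_ && _).
  split=> [[[y hy]]|[y hy]].
    rewrite (val _ hy) => h0; exists y => t tn; rewrite hy //.
    case: eqP => [->|_] //.
    have -> : y l2 = y l1 * (0 - z1 / z2).
      apply: (mulIf nz); rewrite sub0r -mulrA mulNr divfK // mulrN.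
      by apply/eqP; rewrite -addr_eq0 addrC h0.
    by ring.
  (* The coefficient of the absorbed component is recovered from the other. *)
  set y' := fun l => if l == l2 then y l1 * (0 - z1 / z2) else y l.
  have hy' t : (t < n)%N -> c t = y' (lab t) * x t.
    by move=> tn; rewrite hy // /y'; case: eqP => // _; ring.
  split; first by exists y'.
  rewrite (val _ hy') /y' (negPf nl) eqxx sub0r.
  by rewrite mulrN mulNr -mulrA divfK // subrr.
rewrite negb_and !negbK => same.
have val' y : (forall t, (t < n)%N -> c t = y (lab t) * x t) ->
    row_val c r = y l1 * (z1 + z2).
  move=> /val ->; rewrite mulrDr; congr (_ + _).
  by case/orP: same => /eqP ->; rewrite ?mulr0.
rewrite [row_val x r]/row_val -/z1 -/z2.
split=> [[[y hy]]|[y hy]].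
  rewrite (val' _ hy) => h0; exists y => t tn; rewrite hy //.
  case: eqP => [->|_] //; case: eqP => [_|/eqP nz]; first by rewrite mulr1.
  by move/eqP: h0; rewrite mulf_eq0 (negPf nz) orbF => /eqP->; rewrite !mul0r.
set y' := fun l => if (l == l1) && (z1 + z2 != 0) then 0 else y l.
have hy' t : (t < n)%N -> c t = y' (lab t) * x t.
  move=> tn; rewrite hy // /y'; case: (eqVneq (lab t) l1) => [->|] //=.
  by case: eqP => _ /=; rewrite ?mulr1 // mulr0 mulr0 mul0r.
split; first by exists y'.
rewrite (val' _ hy') /y' eqxx /=.
by case: eqP => [->|_] /=; rewrite ?mulr0 ?mul0r.
Qed.

Section Potentials.
Variables (S : pred nat) (lab : nat -> nat) (x : nat -> R).
Hypothesis xP : forall t c, (t < n)%N -> ker S c -> c t = c (lab t).-1 * x t.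
Hypothesis labP : forall r, (r < nL)%N -> S r -> v1 r != 0 -> v2 r != 0 ->
  lab (c1 r) = lab (c2 r).

(** All constrained chains vanish at the root of the component labelled [l],
    hence on the component. *)
Definition refuted l : Prop := forall c, ker S c -> c l.-1 = 0.

Definition respected (bad : nat -> bool) r : Prop :=
  row_val x r = 0 \/
  (v1 r != 0 -> bad (lab (c1 r))) /\ (v2 r != 0 -> bad (lab (c2 r))).

(** On the component of its columns, the row evaluates to the value of the chain
    at the root times the value of the row on the potential. *)
Lemma refuted_row r : (r < nL)%N -> S r -> row_val x r != 0 ->
  refuted (if v1 r != 0 then lab (c1 r) else lab (c2 r)).
Proof.
move=> rL Sr nz c kc; have := kc r rL Sr.
rewrite /row_val (xP (c1_lt rL) kc) (xP (c2_lt rL) kc) => h0.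
have [z1|n1] /= := eqVneq (v1 r) 0.
  move: nz h0; rewrite /row_val z1 !mul0r !add0r mulrCA => /negPf nz /eqP.
  by rewrite mulf_eq0 nz orbF => /eqP.
have e2 : v2 r * c (lab (c2 r)).-1 = v2 r * c (lab (c1 r)).-1.
  by have [->|n2] := eqVneq (v2 r) 0; rewrite ?mul0r // (labP rL Sr n1 n2).
have /eqP : c (lab (c1 r)).-1 * row_val x r = 0.
  rewrite -[RHS]h0 [X in _ = _ + X]mulrA e2 /row_val; ring.
by rewrite mulf_eq0 (negPf nz) orbF => /eqP.
Qed.

(** Setting the potential to 0 on the refuted components makes it satisfy every
    row, so the multiples of it are exactly the constrained chains. *)
Lemma param_potentials (bad : nat -> bool) :
  (forall l, bad l -> refuted l) ->
  (forall r, (r < nL)%N -> S r -> respected bad r) ->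
  param S lab (fun t => if bad (lab t) then 0 else x t).
Proof.
move=> sound complete c; split=> [kc | [y hy] r rL Sr].
  exists (fun l => c l.-1) => t tn; rewrite (xP tn kc).
  by case: ifP => // hb; rewrite (sound _ hb c kc) !mul0r.
rewrite /row_val !hy ?c1_lt ?c2_lt //.
have [n1|n1] := eqVneq (v1 r) 0; have [n2|n2] := eqVneq (v2 r) 0.
- by rewrite n1 n2 !mul0r addr0.
- rewrite n1 !mul0r add0r; have := complete r rL Sr.
  rewrite /respected /row_val n1 mul0r add0r.
  case=> [/eqP|[_ /(_ n2) ->]]; last by rewrite !mulr0.
  rewrite mulf_eq0 (negPf n2) => /eqP ->; by rewrite if_same !mulr0.
- rewrite n2 !mul0r addr0; have := complete r rL Sr.
  rewrite /respected /row_val n2 mul0r addr0.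
  case=> [/eqP|[/(_ n1) -> _]]; last by rewrite !mulr0.
  rewrite mulf_eq0 (negPf n1) => /eqP ->; by rewrite if_same !mulr0.
- rewrite (labP rL Sr n1 n2).
  case: ifP => hb; first by rewrite !mulr0 addr0.
  have [h0|[_ /(_ n2)]] := complete r rL Sr; last by rewrite hb.
  by rewrite -[RHS](mulr0 (y (lab (c2 r)))) -h0 /row_val; ring.
Qed.

End Potentials.
End Kernel.

(** * Loading the matrix and building the search graph *)

Section Loading.
Variables (R : realType) (m n0 nL nL1 : nat).
Implicit Types st : state R.

Definition sizes_in st : Prop :=
  [/\ imem st 0 0 = m, imem st 0 1 = n0, imem st 0 2 = nL & imem st 0 3 = nL1].

(** The first two entries of row [r] of the sparse matrix; an absent entry is
    replaced by the value 0 in the extra column [nL1]. *)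
Definition row_slots st0 (c1 c2 : nat -> nat) (v1 v2 : nat -> R) r : Prop :=
  let ptr := imem st0 1 in
  [/\ c1 r = if (ptr r < ptr r.+1)%N then imem st0 2 (ptr r) else nL1,
      v1 r = if (ptr r < ptr r.+1)%N then rmem st0 0 (ptr r) else 0,
      c2 r = if ((ptr r).+1 < ptr r.+1)%N then imem st0 2 (ptr r).+1 else nL1 &
      v2 r = if ((ptr r).+1 < ptr r.+1)%N then rmem st0 0 (ptr r).+1 else 0].

Definition row_loaded st0 st :=
  row_slots st0 (imem st aC1) (imem st aC2) (rmem st rV1) (rmem st rV2).

Lemma load_rows_spec st0 :
  sizes_in st0 ->
  (forall r, rmem st0 rV1 r = 0) -> (forall r, rmem st0 rV2 r = 0) ->
  runs load_rows st0 (nL.+1 * (ccost load_row + 20)) (fun st =>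
    forall r, (r < nL)%N -> row_loaded st0 st r).
Proof.
move=> [_ _ hL hL1] z1 z2; pose ptr := imem st0 1.
pose I i st := (forall r, (r < i)%N -> row_loaded st0 st r) /\
  (forall r, (i <= r)%N -> rmem st rV1 r = 0 /\ rmem st rV2 r = 0).
apply: (runs_weaken (runs_for (cc := ccost load_row) (n := nL) (I := I) _ _ _ _)).
- by [].
- by move=> st [F _]; rewrite /= F.
- by split=> // r _; split; [apply: z1 | apply: z2].
- move=> i st iL [F1 F2] ei [I1 I2]; apply: runs_straight => //.
  have [w1 w2] := I2 i (leqnn i).
  have f1 j : imem st 1 j = ptr j by apply: F1.
  have f2 j : imem st 2 j = imem st0 2 j by apply: F1.
  have f3 : imem st 0 3 = nL1 by rewrite F1.
  have f4 j : rmem st 0 j = rmem st0 0 j by apply: F2.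
  have f := (ei, f1, f2, f3, f4, addn1).
  rewrite /= /update /= !f.
  have last r : (r < i.+1)%N -> r != i -> (r < i)%N by lia.
  have rest r : (i < r)%N -> (r == i) = false by lia.
  case: (ltnP (ptr i) (ptr i.+1)) => h1 /=; rewrite !f.
    case: (ltnP (ptr i).+1 (ptr i.+1)) => h2 /=; rewrite ?f.
      split=> r /= hr; last by rewrite (rest _ hr); apply: I2; lia.
      rewrite /row_loaded /row_slots /=; case: (eqVneq r i) hr => [->|ne] hr;
        last exact: I1 (last _ hr ne).
      by rewrite h1 h2.
    split=> r /= hr; last by rewrite (rest _ hr); apply: I2; lia.
    rewrite /row_loaded /row_slots /=; case: (eqVneq r i) hr => [->|ne] hr;
    last exact: I1 (last _ hr ne).
    by rewrite h1 ltnNge h2.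
  have h2 : ((ptr i).+1 < ptr i.+1)%N = false by lia.
  rewrite h2; split=> r /= hr; last by apply: I2; lia.
  rewrite /row_loaded /row_slots /=; case: (eqVneq r i) hr => [->|ne] hr;
    last exact: I1 (last _ hr ne).
  by rewrite h2 ltnNge h1.
- by move: (ccost load_row) => k; apply: leq_mul => //=; lia.
- by move=> st [].
Qed.

Lemma mark_rows_spec st0 :
  sizes_in st0 -> (forall r, imem st0 aMARK r = 0%N) ->
  runs mark_rows st0 ((m + n0).+1 * 60) (fun st =>
    forall r, (imem st aMARK r != 0%N)
      = (r \in [seq imem st0 3 j | j <- iota 0 (m + n0)])).
Proof.
move=> [hm hn _ _] z.
apply: (runs_straight_seq (T2 := ((m + n0).+1 * 30)%N)) => //.
  by rewrite /=; lia.
move=> _.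
pose I i st := forall r, (imem st aMARK r != 0%N)
   = (r \in [seq imem st0 3 j | j <- iota 0 i]).
apply: (runs_weaken (runs_for (cc := 10) (n := (m + n0)%N) (I := I) _ _ _ _)) => //.
- by move=> st [F _]; rewrite /= F // /= /update /= hm hn.
- by move=> r; rewrite /= /update /= z.
- move=> i st iL [F1 F2] ei I1.
  apply: (runs_weaken (runs_straight (c := NStore _ _ _)
    (Q := fun st' => I i.+1 (ceval (set_var vj (NConst i.+1)) st')) _ _)) => //.
  move=> r; have -> : iota 0 i.+1 = iota 0 i ++ [:: i] by rewrite -addn1 iotaD.
  rewrite map_cat mem_cat -I1 inE /= /update /= ei F1 //.
  rewrite /= /update /=.
  by case: (eqVneq r (imem st0 3 i)); rewrite ?orbT ?orbF.
- by apply: leq_mul.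
Qed.

Definition links st0 r :=
  [&& imem st0 aMARK r == 0%N, rmem st0 rV1 r != 0 & rmem st0 rV2 r != 0].

(** A constraint with two nonzero coefficients ties the values in its two
    columns; half-edge [2r] leads from the first to the second column and
    [2r+1] back. Sources are stored plus one, 0 marking an unused half-edge. *)
Definition half_edges_built st0 st r : Prop :=
  [/\ imem st aSRC (r + r)%N = if links st0 r then (imem st0 aC1 r).+1 else 0%N,
      imem st aSRC (r + r).+1 = if links st0 r then (imem st0 aC2 r).+1 else 0%N &
      links st0 r ->
      [/\ imem st aTGT (r + r)%N = imem st0 aC2 r,
          rmem st rRAT (r + r)%N = 0 - rmem st0 rV1 r / rmem st0 rV2 r,
          imem st aTGT (r + r).+1 = imem st0 aC1 r &
          rmem st rRAT (r + r).+1 = 0 - rmem st0 rV2 r / rmem st0 rV1 r]].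

Lemma half_edges_spec st0 :
  sizes_in st0 -> (forall r, imem st0 aSRC r = 0%N) ->
  runs half_edges st0 (nL.+1 * (ccost half_edge_pair + 20)) (fun st =>
    forall r, (r < nL)%N -> half_edges_built st0 st r).
Proof.
move=> [_ _ hL _] z; pose Q := half_edges_built st0.
pose I i st := (forall r, (r < i)%N -> Q st r) /\
  (forall g, (i + i <= g)%N -> imem st aSRC g = 0%N).
apply: (runs_weaken (runs_for (cc := ccost half_edge_pair) (n := nL) (I := I) _ _ _ _)).
- by [].
- by move=> st [F _]; rewrite /= F.
- by split=> // r _; apply: z.
- move=> i st iL [F1 F2] ei [I1 I2]; apply: runs_straight => //.
  have f1 j : imem st aC1 j = imem st0 aC1 j by apply: F1.
  have f2 j : imem st aC2 j = imem st0 aC2 j by apply: F1.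
  have f3 j : imem st aMARK j = imem st0 aMARK j by apply: F1.
  have f4 j : rmem st rV1 j = rmem st0 rV1 j by apply: F2.
  have f5 j : rmem st rV2 j = rmem st0 rV2 j by apply: F2.
  have f := (ei, f1, f2, f3, f4, f5, addn1).
  rewrite /= /update /= !f -/(links st0 i).
  case: (boolP (links st0 i)) => ha /=; rewrite ?f.
    split=> [r|g] /= hr; rewrite ?f; last first.
      by rewrite !ifN; [apply: I2; lia | lia | lia].
    rewrite /Q /half_edges_built /= ?f.
    case: (eqVneq r i) hr => [->|ne] hr.
      rewrite !eqxx ha /= (_ : ((i + i)%N == (i + i).+1) = false) ?ltn_eqF //.
    have -> : (r + r == i + i)%N = false by lia.
    have -> : (r + r == (i + i).+1)%N = false by lia.
    have -> : ((r + r).+1 == i + i)%N = false by lia.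
    have -> : ((r + r).+1 == (i + i).+1)%N = false by lia.
    by apply: I1; lia.
  split=> [r|g] /= hr; last by apply: I2; lia.
  case: (eqVneq r i) hr => [->|ne] hr; last by apply: I1; lia.
  by rewrite /Q /half_edges_built /= (negPf ha) !I2 //; lia.
- by move: (ccost half_edge_pair) => k; apply: leq_mul => //=; lia.
- by move=> st [].
Qed.

Lemma link_half_edges_spec st0 :
  sizes_in st0 -> (forall r, imem st0 aHEAD r = 0%N) ->
  let src := imem st0 aSRC in
  runs link_half_edges st0 ((nL + nL).+1 * 60) (fun st =>
    (forall s, imem st aHEAD s = prv src s (nL + nL)) /\
    (forall g, (g < nL + nL)%N -> imem st aNEXT g = prv src (src g) g)).
Proof.
move=> [_ _ hL _] z src.
pose I i st := (forall s, imem st aHEAD s = prv src s i) /\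
    (forall g, (g < i)%N -> imem st aNEXT g = prv src (src g) g).
apply: (runs_weaken (runs_for (cc := 20) (n := (nL + nL)%N) (I := I) _ _ _ _)).
- by [].
- by move=> st [F _]; rewrite /= F // hL.
- by split=> // s; apply: z.
- move=> i st iL [F1 F2] ei [I1 I2].
  apply: (runs_weaken (runs_straight (c := Seq _ _)
    (Q := fun st' => I i.+1 (ceval (set_var vj (NConst i.+1)) st')) _ _)) => //.
  have f1 j : imem st aSRC j = src j by apply: F1.
  rewrite /I /= /update /= !ei !f1 addn1; split=> [s|g hg].
    by rewrite I1 eq_sym.
  case: (eqVneq g i) hg => [->|ne] hg; first exact: I1.
  by apply: I2; lia.
- by apply: leq_mul.
- by [].
Qed.
End Loading.

(** * Contradictory components and output offsets *)
Section Checking.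
Variables (R : realType) (m n0 nL nL1 : nat).
Implicit Types st : state R.
Local Notation sizes_in := (@sizes_in R m n0 nL nL1).

Lemma check_rows_spec n st0 :
  let c1 := imem st0 aC1 in let c2 := imem st0 aC2 in
  let v1 := rmem st0 rV1 in let v2 := rmem st0 rV2 in
  let lab := imem st0 aLAB in let x := rmem st0 rX in
  let S r := imem st0 aMARK r == 0%N in
  sizes_in st0 -> (forall l, imem st0 aBAD l = 0%N) ->
  (forall r, (r < nL)%N -> (c1 r < n)%N) ->
  (forall r, (r < nL)%N -> (c2 r < n)%N) ->
  (forall t c, (t < n)%N -> ker nL c1 c2 v1 v2 S c -> c t = c (lab t).-1 * x t) ->
  (forall r, (r < nL)%N -> S r -> v1 r != 0 -> v2 r != 0 ->
     lab (c1 r) = lab (c2 r)) ->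
  runs check_rows st0 (nL.+1 * 120) (fun st =>
    let bad l := imem st aBAD l != 0%N in
    (forall l, bad l -> refuted nL c1 c2 v1 v2 S l) /\
    (forall r, (r < nL)%N -> S r -> respected c1 c2 v1 v2 lab x bad r)).
Proof.
move=> c1 c2 v1 v2 lab x S [_ _ hL _] z c1_lt c2_lt xP labP.
pose I i st := (forall l, imem st aBAD l != 0%N -> refuted nL c1 c2 v1 v2 S l) /\
    (forall r, (r < i)%N -> S r ->
      respected c1 c2 v1 v2 lab x (fun l => imem st aBAD l != 0%N) r).
apply: (runs_weaken (runs_for (cc := 90) (n := nL) (I := I) _ _ _ _)).
- by [].
- by move=> st [F _]; rewrite /= F.
- by split=> // l /=; rewrite /update /= z.
- move=> i st iL [F1 F2] ei [I1 I2].
  apply: (runs_weaken (runs_straight (c := If _ _ _)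
    (Q := fun st' => I i.+1 (ceval (set_var vr (NConst i.+1)) st')) _ _)) => //.
  have f1 j : imem st aC1 j = c1 j by apply: F1.
  have f2 j : imem st aC2 j = c2 j by apply: F1.
  have f3 j : imem st aMARK j = imem st0 aMARK j by apply: F1.
  have f4 j : rmem st rV1 j = v1 j by apply: F2.
  have f5 j : rmem st rV2 j = v2 j by apply: F2.
  have f6 j : rmem st rX j = x j by apply: F2.
  have f7 j : imem st aLAB j = lab j by apply: F1.
  have f := (ei, f1, f2, f3, f4, f5, f6, f7).
  rewrite [ceval _ _]/= !f -/(S i) -/(row_val c1 c2 v1 v2 x i).
  case: (boolP (S i)) => hS; last first.
    split=> [l|r] /=; first exact: I1.
    case: (eqVneq r i) => [->|ne] hr Sr; first by rewrite Sr in hS.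
    by apply: I2 => //; lia.
  case: (eqVneq (row_val c1 c2 v1 v2 x i) 0) => [h0|h0] /=.
    split=> [l|r] /=; first exact: I1.
    case: (eqVneq r i) => [->|ne] hr Sr; first by left.
    by apply: I2 => //; lia.
  (* Only the component of a nonzero entry is refuted: an absent entry refers to
     the extra column, whose component is not constrained by this row. *)
  have rf := refuted_row c1_lt c2_lt xP labP iL hS h0.
  set bl := if v1 i != 0 then _ else _ in rf.
  pose st1 := State (update (imem st) aBAD bl 1%N) (rmem st).
  have -> : (if v1 i != 0
    then State (update (imem st) 28 (lab (c1 i)) 1%N) (rmem st)
    else State (update (imem st) 28 (lab (c2 i)) 1%N) (rmem st)) = st1.
    by rewrite /st1 /bl; case: ifP.
  have mono l : imem st aBAD l != 0%N -> imem st1 aBAD l != 0%N.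
    by rewrite /st1 /= /update /=; case: ifP.
  have hbl : imem st1 aBAD bl != 0%N by rewrite /st1 /= /update /= eqxx.
  split=> [l|r].
    rewrite /= /update /=; case: (eqVneq l bl) => [->|_] //=; exact: I1.
  move=> hr Sr; case: (eqVneq r i) hr => [-> _|ne hr]; last first.
    have [|[a b]] := I2 r ltac:(lia) Sr; first by left.
    by right; split=> [/a|/b]; apply: mono.
  right; split=> n1.
    by move: hbl; rewrite /bl n1.
  have -> : lab (c2 i) = bl; last exact: hbl.
  by rewrite /bl; case: (eqVneq (v1 i) 0) => //= n1'; rewrite labP.
- by apply: leq_mul.
- by [].
Qed.

Lemma kill_bad_spec n st0 : imem st0 vN 0 = n ->
  runs kill_bad st0 (n.+1 * 50) (fun st => forall t, (t < n)%N ->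
    rmem st rX t = if imem st0 aBAD (imem st0 aLAB t) != 0%N then 0
                   else rmem st0 rX t).
Proof.
move=> hn.
pose I i st := forall t,
    rmem st rX t = if (t < i)%N && (imem st0 aBAD (imem st0 aLAB t) != 0%N) then 0
                   else rmem st0 rX t.
apply: (runs_weaken (runs_for (cc := 30) (n := n) (I := I) _ _ _ _)).
- by [].
- by move=> st [F _]; rewrite /= F.
- by [].
- move=> i st iL [F1 F2] ei I1.
  apply: (runs_weaken (runs_straight (c := If _ _ _)
    (Q := fun st' => I i.+1 (ceval (set_var vt (NConst i.+1)) st')) _ _)) => //.
  rewrite [ceval _ _]/= !ei !F1 // => t.
  have e0 : (t < i.+1)%N = (t == i) || (t < i)%N by rewrite ltnS leq_eqVlt.
  rewrite e0; case: (eqVneq (imem st0 _ (imem st0 _ i)) 0%N) => hb /=.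
    rewrite I1; case: (eqVneq t i) => [->|] //=; by rewrite ltnn hb.
  rewrite /update /= ; case: (eqVneq t i) => [->|] //=; by rewrite hb.
- by apply: leq_mul.
- by move=> st h t tn; rewrite h tn.
Qed.

Lemma offsets_spec st0 : sizes_in st0 ->
  imem st0 vpos 0 = 0%N -> imem st0 vacc 0 = 0%N ->
  runs offsets st0 (m.+2 * ((n0 + m).+1 * 120)) (fun st => forall i, (i <= m)%N ->
    imem st aOFFD i = (\sum_(k < i) (n0 + k) ^ 2)%N /\
    imem st aOFFW i = (\sum_(k < i) (n0 + k))%N).
Proof.
move=> [hm hn _ _] p0 a0.
pose I i st := [/\ imem st vpos 0 = (\sum_(k < i) (n0 + k) ^ 2)%N,
  imem st vacc 0 = (\sum_(k < i) (n0 + k))%N &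
  forall j, (j < i)%N ->
    imem st aOFFD j = (\sum_(k < j) (n0 + k) ^ 2)%N /\
    imem st aOFFW j = (\sum_(k < j) (n0 + k))%N].
apply: (runs_weaken (runs_for (cc := (n0 + m).+1 * 80) (n := m.+1) (I := I) _ _ _ _)).
- by [].
- by move=> st [F _]; rewrite /= F // hm addn1.
- by split; rewrite ?big_ord0.
- move=> i st iL [F1 F2] ei [I1 I2 I3].
  apply: (runs_straight_seq (T2 := ((n0 + m).+1 * 70)%N)) => //=; first by lia.
  move=> _; apply: (runs_straight_seq (T2 := ((n0 + m).+1 * 60)%N)) => //=; first by lia.
  move=> _; apply: (runs_straight_seq (T2 := ((n0 + m).+1 * 50)%N)) => //=; first by lia.
  move=> _; rewrite /update /= ei F1 // hn.
  set st1 := State _ _.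
  pose J j st' := [/\ imem st' vpos 0 = (imem st vpos 0 + j * (n0 + i))%N,
    forall j', imem st' aOFFD j' = imem st1 aOFFD j',
    forall j', imem st' aOFFW j' = imem st1 aOFFW j' &
    imem st' vacc 0 = imem st vacc 0].
  have L : runs (For vj (var vni) (set_var vpos (NAdd (var vpos) (var vni)))) st1
     ((n0 + i).+1 * 30) (fun st' => J (n0 + i)%N st' /\ imem st' vni 0 = (n0 + i)%N).
    apply: (runs_weaken (runs_frame (runs_for (cc := 10) (n := (n0 + i)%N) (I := J) _ _ _ _))).
    - by [].
    - by move=> st2 [F _]; rewrite /= F.
    - by split=> //=; rewrite mul0n addn0.
    - move=> j st2 jn [G1 G2] ej [J1 J2 J3 J4].
      apply: (runs_weaken (runs_straight (c := set_var _ _)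
        (Q := fun st' => J j.+1 (ceval (set_var vj (NConst j.+1)) st')) _ _)) => //.
      split=> //; rewrite /= /update /= J1 G1 //= mulSn; lia.
    - by apply: leq_mul.
    - by move=> st2 [J2 [G _]]; split=> //; rewrite G.
  apply: (runs_weaken (runs_seq L (T2 := 10) (Q2 := fun st' => I i.+1
     (ceval (set_var vi (NConst i.+1)) st')) _)) => //; last by lia.
  move=> st2 [[J1 J2 J3 J4] J5] _.
  apply: (runs_weaken (runs_straight (c := set_var _ _)
        (Q := fun st' => I i.+1 (ceval (set_var vi (NConst i.+1)) st')) _ _)) => //.
  split=> /=.
  - by rewrite /update /= J1 I1 big_ord_recr /= mulnn.
  - by rewrite /update /= J4 J5 I2 big_ord_recr.
  move=> j hj; rewrite /update /= J2 J3 /=.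
  case: (eqVneq j i) hj => [->|ne] hj; last by apply: I3; lia.
  by rewrite I1 I2.
- by apply: leq_mul => //=; lia.
- by move=> st [_ _ h] i hi; apply: h.
Qed.
End Checking.

(** * One stage: norms and matrix entries *)
Ltac enum_cells :=
  rewrite !inE; repeat first [case/orP | move/eqP->].

Section Emission.
Variables (R : realType) (m n0 nL nL1 : nat).
Implicit Types st : state R.
Local Notation sizes_in := (@sizes_in R m n0 nL nL1).

(** Squared norm of the potential on the component [l]. *)
Definition norm_sum n (lab : nat -> nat) (x w : nat -> R) l : R :=
  \sum_(t < n | lab t == l) x t * x t / w t.

Lemma norms_spec n st0 : imem st0 vN 0 = n ->
  (forall t, (t < n)%N -> (imem st0 aLAB t <= n)%N) ->
  runs compute_norms st0 (n.+2 * 100) (fun st => forall l, (l <= n)%N ->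
    rmem st rNRM l = norm_sum n (imem st0 aLAB) (rmem st0 rX) (rmem st0 2) l).
Proof.
move=> hn hlab.
have L : runs clear_norms st0 (n.+2 * 30)
    (fun st => forall l, (l <= n)%N -> rmem st rNRM l = 0).
  pose I i st := forall l, (l < i)%N -> rmem st rNRM l = 0.
  apply: (runs_weaken (runs_for (cc := 8) (n := n.+1) (I := I) _ _ _ _)).
  - by [].
  - by move=> st [F _]; rewrite /= F // hn addn1.
  - by [].
  - move=> i st iL [F1 F2] ei I1.
    apply: (runs_weaken (runs_straight (c := RStore _ _ _)
      (Q := fun st' => I i.+1 (ceval (set_var vt (NConst i.+1)) st')) _ _)) => //.
    move=> t ht; rewrite /= /update /= ei; case: (eqVneq t i) ht => // ne ht.
    by apply: I1; lia.
  - by apply: leq_mul.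
  - by [].
apply: (runs_weaken (runs_seq L (T2 := (n.+2 * 50)%N) _)); last 2 first.
- by lia.
- by move=> st; apply.
move=> st1 z [G1 G2].
pose I i st := forall l, (l <= n)%N -> rmem st rNRM l =
  norm_sum i (imem st0 aLAB) (rmem st0 rX) (rmem st0 2) l.
apply: (runs_weaken (runs_for (cc := 30) (n := n) (I := I) _ _ _ _)).
- by [].
- by move=> st [F _]; rewrite /= F // G1.
- by move=> l hl; rewrite /= z // /norm_sum big_ord0.
- move=> i st iL [F1 F2] ei I1.
  apply: (runs_weaken (runs_straight (c := RStore _ _ _)
    (Q := fun st' => I i.+1 (ceval (set_var vt (NConst i.+1)) st')) _ _)) => //.
  have fl j : imem st aLAB j = imem st0 aLAB j by rewrite F1 // G1.
  have fx j : rmem st rX j = rmem st0 rX j by rewrite F2 // G2.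
  have fw j : rmem st 2 j = rmem st0 2 j by rewrite F2 // G2.
  move=> l hl; rewrite /= ei fl fx fw /update /=.
  rewrite /norm_sum big_mkcond big_ord_recr -big_mkcond /= [l == _]eq_sym.
  rewrite (I1 (imem st0 aLAB i)) ?hlab //.
  by case: eqP => [->|_] //; rewrite addr0 I1.
- by apply: leq_mul.
- by [].
Qed.

Section Env.
Variables (c1 c2 : nat -> nat) (v1 v2 : nat -> R).
Variables (lab : nat -> nat) (x nrm : nat -> R).

Definition lap_term ca za cb zb : R :=
  if lab ca == lab cb then za * zb / nrm (lab ca) else 0.

(** The entry of the Laplacian at the rows [ra] and [rb], before division by the
    weight of the column: basis chains of the components are orthogonal, so only
    cofaces in a common component interact. *)
Definition lap_entry ra rb : R :=
  lap_term (c1 ra) (v1 ra * x (c1 ra)) (c1 rb) (v1 rb * x (c1 rb)) +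
  lap_term (c1 ra) (v1 ra * x (c1 ra)) (c2 rb) (v2 rb * x (c2 rb)) +
  lap_term (c2 ra) (v2 ra * x (c2 ra)) (c1 rb) (v1 rb * x (c1 rb)) +
  lap_term (c2 ra) (v2 ra * x (c2 ra)) (c2 rb) (v2 rb * x (c2 rb)).

Definition env st : Prop :=
  [/\ imem st aC1 =1 c1, imem st aC2 =1 c2 & imem st aLAB =1 lab] /\
  [/\ rmem st rV1 =1 v1, rmem st rV2 =1 v2, rmem st rX =1 x &
      forall t, rmem st rNRM (lab t) = nrm (lab t)].

Lemma env_ext st st' : env st ->
  (forall a i, a \in [:: aC1; aC2; aLAB] -> imem st' a i = imem st a i) ->
  (forall a i, a \in [:: rV1; rV2; rX; rNRM] -> rmem st' a i = rmem st a i) ->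
  env st'.
Proof.
move=> [[e1 e2 e3] [e4 e5 e6 e7]] h1 h2.
by split; split=> j; rewrite ?h1 ?h2.
Qed.

Lemma slot1E st e : env st ->
  reval st (slot1 e) = v1 (neval st e) * x (c1 (neval st e)).
Proof. by move=> [[e1 e2 e3] [e4 e5 e6 e7]]; rewrite /= e4 e6 e1. Qed.

Lemma slot2E st e : env st ->
  reval st (slot2 e) = v2 (neval st e) * x (c2 (neval st e)).
Proof. by move=> [[e1 e2 e3] [e4 e5 e6 e7]]; rewrite /= e5 e6 e2. Qed.

(** The final memory is described cell by cell, since the two branches of the
    conditional leave different but pointwise equal functions. *)
Lemma add_term_eval cp cq sp sq (cP cQ : nat -> nat) (zP zQ : nat -> R) st :
  env st -> imem st cp =1 cP -> imem st cq =1 cQ ->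
  (forall e, reval st (sp e) = zP (neval st e)) ->
  (forall e, reval st (sq e) = zQ (neval st e)) ->
  let ra := imem st vra 0 in let rb := imem st vrb 0 in
  let st' := ceval (add_term cp cq sp sq) st in
  [/\ rmem st' racc 0 =
        rmem st racc 0 + lap_term (cP ra) (zP ra) (cQ rb) (zQ rb),
      imem st' = imem st &
      forall a i, a != racc -> rmem st' a i = rmem st a i].
Proof.
move=> [[e1 e2 e3] [e4 e5 e6 e7]] hp hq hzp hzq ra rb /=.
rewrite hzp hzq /= !e3 hp hq -/ra -/rb e7 /lap_term.
case: ifP => _; last by rewrite addr0.
by split=> //= a i /negPf ha; rewrite /update ha.
Qed.

Lemma emit_entry_eval st : env st ->
  let st' := ceval emit_entry st in
  let ra := imem st vra 0 in let rb := imem st 3 (imem st vb 0) in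
  (forall p, rmem st' 3 p = if p == imem st vpos 0 then
     lap_entry ra rb / rmem st 1 (imem st aOFFW (imem st vi 0) + imem st vb 0)%N
     else rmem st 3 p)
  /\ imem st' vpos 0 = (imem st vpos 0).+1.
Proof.
move=> E st' ra rb.
set st1 := ceval (RStore racc (NConst 0) (RConst 0))
  (ceval (set_var vrb (NLoad 3 (var vb))) st).
have E1 : env st1.
  apply: (env_ext E) => a i; rewrite !inE => ha; rewrite /st1 /= /update /=;
  by move: ha; do ?[case/orP=> [/eqP-> //|]]; move/eqP->.
have ind : forall cp cq sp sq (cP cQ : nat -> nat) (zP zQ : nat -> R) s,
  env s -> (imem s cp =1 cP) -> (imem s cq =1 cQ) ->
  (forall e, reval s (sp e) = zP (neval s e)) ->
  (forall e, reval s (sq e) = zQ (neval s e)) ->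
  imem s = imem st1 -> (forall a i, a != racc -> rmem s a i = rmem st1 a i) ->
  let s' := ceval (add_term cp cq sp sq) s in
  [/\ rmem s' racc 0 = rmem s racc 0 + lap_term (cP ra) (zP ra) (cQ rb) (zQ rb),
      env s', imem s' = imem st1 &
      forall a i, a != racc -> rmem s' a i = rmem st1 a i].
  move=> cp cq sp sq cP cQ zP zQ s Es hp hq hzp hzq hi hr s'.
  have [a1 a2 a3] := add_term_eval Es hp hq hzp hzq.
  split; rewrite ?a2 //.
  - by rewrite a1 hi.
  - apply: (env_ext Es) => a i; rewrite ?a2 // !inE => ha.
    by rewrite a3 //; apply: contraTneq ha => ->.
  - by move=> a i ha; rewrite a3 // hr.
have [[i1 i2 _] _] := E1.
pose z1 r := v1 r * x (c1 r); pose z2 r := v2 r * x (c2 r).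
have [r2 E2 j2 k2] := ind aC1 aC1 slot1 slot1 c1 c1 z1 z1 st1 E1 i1 i1
  (fun e => slot1E e E1) (fun e => slot1E e E1) erefl (fun _ _ _ => erefl).
set st2 := ceval _ st1 in r2 E2 j2 k2.
rewrite -j2 in i1 i2.
have [r3 E3 j3 k3] := ind aC1 aC2 slot1 slot2 c1 c2 z1 z2 st2 E2 i1 i2
  (fun e => slot1E e E2) (fun e => slot2E e E2) j2 k2.
set st3 := ceval _ st2 in r3 E3 j3 k3.
rewrite j2 -j3 in i1 i2.
have [r4 E4 j4 k4] := ind aC2 aC1 slot2 slot1 c2 c1 z2 z1 st3 E3 i2 i1
  (fun e => slot2E e E3) (fun e => slot1E e E3) j3 k3.
set st4 := ceval _ st3 in r4 E4 j4 k4.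
rewrite j3 -j4 in i1 i2.
have [r5 E5 j5 k5] := ind aC2 aC2 slot2 slot2 c2 c2 z2 z2 st4 E4 i2 i2
  (fun e => slot2E e E4) (fun e => slot2E e E4) j4 k4.
set st5 := ceval _ st4 in r5 E5 j5 k5.
rewrite /st' /emit_entry !cevalS -/st1 -/st2 -/st3 -/st4 -/st5.
have acc : rmem st5 racc 0 = lap_entry ra rb.
  by rewrite r5 r4 r3 r2 /st1 /= /update /= add0r.
split=> [p|].
  rewrite /= /update /= j5 acc !k5 //.
by rewrite /= /update /= j5 addn1.
Qed.

(** The output position is a running counter; the row and column of the entry
    written at offset [j] are recovered as quotient and remainder of [j] by the
    size of the matrix. *)
Lemma emit_spec i ni st0 : env st0 ->
  imem st0 vi 0 = i -> imem st0 vni 0 = ni ->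
  runs emit st0 (ni.+1 * (ni.+1 * (ccost emit_entry + 100))) (fun st =>
    forall p, let p0 := imem st0 aOFFD i in let j := (p - p0)%N in
    rmem st 3 p = if (p0 <= p < p0 + ni * ni)%N then
      lap_entry (imem st0 3 (j %/ ni)) (imem st0 3 (j %% ni))
        / rmem st0 1 (imem st0 aOFFW i + j %% ni)%N
    else rmem st0 3 p).
Proof.
move=> E hi hni.
pose p0 := imem st0 aOFFD i.
pose val j := lap_entry (imem st0 3 (j %/ ni)) (imem st0 3 (j %% ni))
        / rmem st0 1 (imem st0 aOFFW i + j %% ni)%N.
pose J k st := imem st vpos 0 = (p0 + k)%N /\ forall p,
  rmem st 3 p = if (p0 <= p < p0 + k)%N then val (p - p0)%N else rmem st0 3 p.
apply: (runs_straight_seq (T2 := (ni.+1 * (ni.+1 * (ccost emit_entry + 90)))%N)) => //.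
  by rewrite /=; move: (ccost emit_entry) => k; nia.
move=> [G1 G2]; set st1 := ceval _ st0.
have J0 : J 0%N st1.
  split=> [|p]; first by rewrite /st1 /= /update /= hi addn0.
  by rewrite addn0 ltnNge andbN.
pose I a st := J (a * ni)%N st.
apply: (runs_weaken (runs_for (cc := (ni.+1 * (ccost emit_entry + 50))%N)
  (n := ni) (I := I) _ _ _ _)).
- by [].
- by move=> st [F _]; rewrite /= F // G1.
- exact: J0.
- move=> a st an [F1 F2] ea I1.
  have k1 c j : c \in [:: aC1; aC2; aLAB; vi; vni; 3; aOFFW] ->
      imem st c j = imem st0 c j.
    by enum_cells; rewrite F1 // G1.
  have k2 c j : c \in [:: rV1; rV2; rX; rNRM; 1] -> rmem st c j = rmem st0 c j.
    by enum_cells; rewrite F2 // G2.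
  apply: (runs_straight_seq (T2 := (ni.+1 * (ccost emit_entry + 40))%N)) => //.
    by rewrite /=; move: (ccost emit_entry) => k; nia.
  move=> _; set st2 := ceval _ st.
  have ra2 : imem st2 vra 0 = imem st0 3 a by rewrite /st2 /= /update /= ea k1.
  pose K b st := J (a * ni + b)%N st.
  apply: (runs_weaken (runs_for (cc := ccost emit_entry) (n := ni) (I := K) _ _ _ _)).
  + by [].
  + by move=> st3 [F _]; rewrite /= F // /st2 /= /update /= k1.
  + by rewrite /K addn0; exact: I1.
  + move=> b st3 bn [H1 H2] eb [K1 K2]; apply: runs_straight => //.
    have l1 c j : c \in [:: aC1; aC2; aLAB; vi; 3; aOFFW] ->
        imem st3 c j = imem st0 c j.
      by enum_cells; rewrite H1 // -k1.
    have l2 c j : c \in [:: rV1; rV2; rX; rNRM; 1] -> rmem st3 c j = rmem st0 c j.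
      by enum_cells; rewrite H2 // -k2.
    have E3 : env st3.
      by apply: (env_ext E) => c j; enum_cells; rewrite ?l1 ?l2.
    have ra3 : imem st3 vra 0 = imem st0 3 a by rewrite H1.
    move: (ceval emit_entry st3) (emit_entry_eval E3) => st4 [e1 e2].
    split=> [|p].
      by rewrite /= /update /= e2 K1 !addnS.
    rewrite [LHS]e1 K1 K2 ra3 eb !l1 // hi l2 //.
    case: (eqVneq p (p0 + (a * ni + b))%N) => [->|ne].
      rewrite leq_addr ltn_add2l addnS ltnSn /= /val addKn divnMDl ?modnMDl; last by lia.
      by rewrite divn_small // addn0 modn_small.
    by congr (if _ then _ else _); lia.
  + by move: (ccost emit_entry) => k; apply: leq_mul => //=; lia.
  + by move=> st3; rewrite /K /I /= mulSn addnC => hJ; exact: hJ.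
- by move: (ccost emit_entry) => k; apply: leq_mul => //=; nia.
- by move=> st [_ h] p; rewrite h.
Qed.
End Env.
End Emission.

(** * Adding a constraint and iterating the stages *)
Section Merging.
Variables (R : realType) (m n0 nL nL1 : nat).
Implicit Types st : state R.
Local Notation sizes_in := (@sizes_in R m n0 nL nL1).

Lemma merge_spec n ni st0 : imem st0 vN 0 = n -> imem st0 vni 0 = ni ->
  let c1 := imem st0 aC1 in let c2 := imem st0 aC2 in
  let v1 := rmem st0 rV1 in let v2 := rmem st0 rV2 in
  let lab := imem st0 aLAB in let x := rmem st0 rX in
  let r := imem st0 3 (ni - 1)%N in
  runs merge_labels st0 (n.+1 * (ccost merge_setup + 60)) (fun st =>
    forall t, (t < n)%N ->
    imem st aLAB t = (if lab t == merge_from c1 c2 v2 lab x r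
                      then lab (c1 r) else lab t) /\
    rmem st rX t = (if lab t == merge_from c1 c2 v2 lab x r
                    then x t * merge_factor c1 c2 v1 v2 lab x r else x t)).
Proof.
move=> hn hni c1 c2 v1 v2 lab x r.
apply: (runs_straight_seq (T2 := (n.+1 * 50)%N)) => //.
  by move: (ccost merge_setup) => k; nia.
move=> [G1 G2].
have [f1 f2 f3] : [/\ imem (ceval merge_setup st0) vfrom 0
    = merge_from c1 c2 v2 lab x r,
  imem (ceval merge_setup st0) vto 0 = lab (c1 r) &
  rmem (ceval merge_setup st0) rfac 0 = merge_factor c1 c2 v1 v2 lab x r].
  rewrite /merge_from /merge_factor /joins /row_val.
  rewrite /= /update /= hni -/r -/(c1 r) -/(c2 r) -/(v1 r) -/(v2 r).
  case: (eqVneq (v1 r * x (c1 r) + v2 r * x (c2 r)) 0) => h0 /=;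
  (case: (eqVneq (lab (c1 r)) (lab (c2 r))) => h1 /=;
   [|case: (eqVneq (v2 r * x (c2 r)) 0) => h2 /=]); by [].
move: (ceval merge_setup st0) G1 G2 f1 f2 f3 => st1 G1 G2 f1 f2 f3.
set fr := merge_from _ _ _ _ _ _ in f1 *; set fc := merge_factor _ _ _ _ _ _ _ in f3 *.
pose Q t st := imem st aLAB t = (if lab t == fr then lab (c1 r) else lab t) /\
    rmem st rX t = (if lab t == fr then x t * fc else x t).
pose I i st := (forall t, (t < i)%N -> Q t st) /\ forall t, (i <= t)%N ->
  imem st aLAB t = lab t /\ rmem st rX t = x t.
apply: (runs_weaken (runs_for (cc := 30) (n := n) (I := I) _ _ _ _)).
- by [].
- by move=> st [F _]; rewrite /= F // G1.
- by split=> // t _; split; [apply: G1 | apply: G2].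
- move=> i st iL [F1 F2] ei [I1 I2].
  apply: (runs_weaken (runs_straight (c := If _ _ _)
    (Q := fun st' => I i.+1 (ceval (set_var vt (NConst i.+1)) st')) _ _)) => //.
  have [li xi] := I2 i (leqnn i).
  have ff : imem st vfrom 0 = fr by rewrite F1.
  have ft : imem st vto 0 = lab (c1 r) by rewrite F1.
  have fx : rmem st rfac 0 = fc by rewrite F2.
  have last t : (t < i.+1)%N -> t != i -> (t < i)%N by lia.
  rewrite [ceval _ _]/= ei li ff; case: (eqVneq (lab i) fr) => hf; split=> t ht.
  + rewrite /Q /= /update /= ?ei xi ft fx.
    case: (eqVneq t i) ht => [->|ne] ht; first by rewrite hf eqxx.
    exact: I1 (last _ ht ne).
  + rewrite /= /update /= ?ei (_ : (t == i) = false); last by lia.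
    by apply: I2; lia.
  + rewrite /Q /= /update /=.
    case: (eqVneq t i) ht => [->|ne] ht; first by rewrite (negPf hf) li xi.
    exact: I1 (last _ ht ne).
  + by apply: I2; lia.
- by apply: leq_mul.
- by move=> st [].
Qed.

Section Main.
Variables (ks c1 c2 offD offW : nat -> nat) (v1 v2 w wk : nat -> R).
Let n := nL1.+1.
Hypothesis c1_lt : forall r, (r < nL)%N -> (c1 r < n)%N.
Hypothesis c2_lt : forall r, (r < nL)%N -> (c2 r < n)%N.
Hypothesis ks_lt : forall j, (j < n0 + m)%N -> (ks j < nL)%N.
Hypothesis ks_inj : forall j j', (j < n0 + m)%N -> (j' < n0 + m)%N ->
  ks j = ks j' -> j = j'.
Hypothesis offD_step : forall i, (i < m)%N ->
  offD i.+1 = (offD i + (n0 + i) * (n0 + i))%N.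

(** The rows outside K_i. *)
Definition removed i : pred nat :=
  [pred r | r \notin [seq ks j | j <- iota 0 (n0 + i)]].

Record fixed_data st : Prop := FixedData {
  fd_sizes : sizes_in st;
  fd_N : imem st vN 0 = n;
  fd_ks : imem st 3 =1 ks;
  fd_c1 : imem st aC1 =1 c1;
  fd_c2 : imem st aC2 =1 c2;
  fd_offD : forall i, (i <= m)%N -> imem st aOFFD i = offD i;
  fd_offW : forall i, (i <= m)%N -> imem st aOFFW i = offW i;
  fd_v1 : rmem st rV1 =1 v1;
  fd_v2 : rmem st rV2 =1 v2;
  fd_w : rmem st 2 =1 w;
  fd_wk : rmem st 1 =1 wk
}.

(** What holds before the stage of K_i, and what that stage leaves behind. *)
Definition current i st : Prop :=
  param n nL c1 c2 v1 v2 (removed i) (imem st aLAB) (rmem st rX) /\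
  (forall t, (t < n)%N -> (imem st aLAB t <= n)%N).

Definition emitted i st : Prop := exists lab x,
  param n nL c1 c2 v1 v2 (removed i) lab x /\
  (forall t, (t < n)%N -> (lab t <= n)%N) /\
  forall a b, (a < n0 + i)%N -> (b < n0 + i)%N ->
    rmem st 3 (offD i + a * (n0 + i) + b)%N =
    lap_entry c1 c2 v1 v2 lab x (norm_sum n lab x w) (ks a) (ks b)
      / wk (offW i + b)%N.

(** The q-simplex added at step [i + 1] is listed at position [n0 + i]. *)
Lemma removed_step i : (i < m)%N -> forall r,
  predU1 (ks (n0 + i)%N) (removed i.+1) r = removed i r.
Proof.
move=> im r.
have e : iota 0 (n0 + i.+1) = iota 0 (n0 + i) ++ [:: (n0 + i)%N].
  by rewrite addnS -addn1 iotaD.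
rewrite /removed /= e map_cat mem_cat inE /= negb_or.
case: (eqVneq r _) => [->|_] /=; last by rewrite andbT.
apply/esym/mapP=> -[j]; rewrite mem_iota => /andP[_ hj] /ks_inj h.
by have := h ltac:(lia) ltac:(lia); lia.
Qed.

Lemma offD_mono i j : (i < j)%N -> (j <= m)%N ->
  (offD i + (n0 + i) * (n0 + i) <= offD j)%N.
Proof.
elim: j => // j IH; rewrite ltnS leq_eqVlt => /predU1P[->|lt] jm.
  by rewrite offD_step.
by rewrite offD_step //; apply: leq_trans (IH lt (ltnW jm)) _; apply: leq_addr.
Qed.

Lemma fixed_frame c st st' : fixed_data st -> frame c st st' ->
  all (fun a => a \notin iwrites c) [:: 0; vN; 3; aC1; aC2; aOFFD; aOFFW]%N ->
  all (fun a => a \notin rwrites c) [:: rV1; rV2; 2; 1]%N ->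
  fixed_data st'.
Proof.
move=> [[h1 h2 h3 h4] ? ? ? ? ? ? ? ? ? ?] [F1 F2] /allP A1 /allP A2.
have k1 a i : a \in [:: 0; vN; 3; aC1; aC2; aOFFD; aOFFW]%N ->
    imem st' a i = imem st a i by move=> /A1; apply: F1.
have k2 a i : a \in [:: rV1; rV2; 2; 1]%N ->
    rmem st' a i = rmem st a i by move=> /A2; apply: F2.
by split; try split; move=> *; rewrite ?k1 ?k2 //; auto.
Qed.

Definition stage_cost :=
  (((n0 + m).+1 * (n0 + m).+1 + n.+2) *
   (ccost emit_entry + ccost merge_setup + 400))%N.

(** A stage writes only within its own block of the output, so earlier stages
    keep theirs. *)
Lemma stage_spec s i st0 : (i + s)%N = m -> imem st0 vs 0 = s ->
  fixed_data st0 -> current i st0 ->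
  runs stage st0 stage_cost (fun st =>
    [/\ (0 < i)%N -> current i.-1 st, emitted i st &
        forall p, ~~ (offD i <= p < offD i + (n0 + i) * (n0 + i))%N ->
          rmem st 3 p = rmem st0 3 p]).
Proof.
move=> ism hs D [P lab_le].
have im : (i <= m)%N by lia.
have [sm sn sL sL1] := fd_sizes D.
have hi : (m - s)%N = i by lia.
pose ni := (n0 + i)%N.
pose ke := (ccost emit_entry + 100)%N; pose km := (ccost merge_setup + 60)%N.
apply: (runs_straight_seq (T2 := (20 + (n.+2 * 100 + (ni.+1 * (ni.+1 * ke) + n.+1 * km)))%N)) => //.
  rewrite [ccost _]/= /stage_cost /ni /ke /km.
  move: (ccost emit_entry) (ccost merge_setup) => a b.
  have -> : (n0 + m = (n0 + i) + s)%N by lia.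
  by move: (n0 + i)%N n => y z; nia.
move=> _.
apply: (runs_straight_seq (T2 := (n.+2 * 100 + (ni.+1 * (ni.+1 * ke) + n.+1 * km))%N)) => //.
  by rewrite [ccost _]/= leq_add2r.
move=> _; set st2 := ceval _ (ceval _ st0).
have vi2 : imem st2 vi 0 = i by rewrite /st2 /= /update /= sm hs.
have vni2 : imem st2 vni 0 = ni by rewrite /st2 /= /update /= sm sn hs hi.
have D2 : fixed_data st2.
  by apply: (fixed_frame (c := set_var vi (NConst 0) ;; set_var vni (NConst 0)) D);
     [split=> // a j /=; rewrite !inE negb_or => /andP[/negPf h1 /negPf h2];
      rewrite /st2 /= /update h1 h2 |..].
set lab := imem st0 aLAB in P lab_le; set x := rmem st0 rX in P.
apply: (runs_seq (norms_spec (n := n) (st0 := st2) (fd_N D2) lab_le)).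
move=> st3 N3 F3.
have D3 := fixed_frame D2 F3 isT isT; have [G1 G2] := F3.
pose nrm := rmem st3 rNRM.
have E3 : env c1 c2 v1 v2 lab x nrm st3.
  split; split=> j //; rewrite ?(fd_c1 D3) ?(fd_c2 D3) ?(fd_v1 D3) ?(fd_v2 D3) //.
    exact: G1.
  exact: G2.
apply: (runs_seq (emit_spec (i := i) (ni := ni) E3 _ _)).
- by rewrite G1.
- by rewrite G1.
move=> st4 O4 F4; have [H1 H2] := F4.
have D4 := fixed_frame D3 F4 isT isT.
have l4 j : imem st4 aLAB j = lab j by rewrite H1 // G1.
have x4 j : rmem st4 rX j = x j by rewrite H2 // G2.
have M := merge_spec (n := n) (ni := ni) (st0 := st4).
apply: (runs_weaken (runs_frame (M _ _))) => //.
- by rewrite (fd_N D4).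
- by rewrite H1 // G1.
move=> st5 [M5 [K1 K2]].
have o5 p : rmem st5 3 p = rmem st4 3 p by apply: K2.
split.
- case: (posnP i) => // i0 _.
  have hr : imem st4 3 (ni - 1) = ks (n0 + i.-1)%N.
    by rewrite (fd_ks D4) /ni; congr ks; lia.
  have rL : (ks (n0 + i.-1) < nL)%N by apply: ks_lt; lia.
  set r := ks _ in hr rL.
  have fr : merge_from (imem st4 aC1) (imem st4 aC2) (rmem st4 rV2)
      (imem st4 aLAB) (rmem st4 rX) r = merge_from c1 c2 v2 lab x r.
    by rewrite /merge_from /joins !l4 !x4 !(fd_c1 D4) !(fd_c2 D4) !(fd_v2 D4).
  have fc : merge_factor (imem st4 aC1) (imem st4 aC2) (rmem st4 rV1)
      (rmem st4 rV2) (imem st4 aLAB) (rmem st4 rX) r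
      = merge_factor c1 c2 v1 v2 lab x r.
    rewrite /merge_factor /joins /row_val.
    by rewrite !l4 !x4 !(fd_c1 D4) !(fd_c2 D4) !(fd_v1 D4) !(fd_v2 D4).
  rewrite hr in M5.
  split=> [|t tn]; last first.
    have [-> _] := M5 t tn; rewrite !l4 (fd_c1 D4).
    by case: ifP => _; apply: lab_le => //; apply: c1_lt.
  have Pm := param_merge c1_lt c2_lt rL P.
  apply: (eq_param _ _ _ Pm) => [s' _|t tn|t tn].
  + by rewrite -removed_step ?prednK //; lia.
  + by have [-> _] := M5 t tn; rewrite !l4 (fd_c1 D4) fr.
  + by have [_ ->] := M5 t tn; rewrite !l4 x4 fr fc.
- exists lab, x; split=> //; split=> // a b ha hb.
  rewrite o5 O4 (fd_offD D3) // (fd_offW D3) // -addnA addKn leq_addr ltn_add2l.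
  have -> : (a * (n0 + i) + b < (n0 + i) * (n0 + i))%N by nia.
  rewrite divnMDl ?modnMDl ?divn_small ?addn0 ?modn_small //; last by lia.
  rewrite !(fd_ks D3) (fd_wk D3); congr (_ / _).
  have nrmE c : (c < n)%N -> nrm (lab c) = norm_sum n lab x w (lab c).
    move=> cn; rewrite /nrm N3 ?lab_le // /norm_sum.
    by apply: eq_bigr => t _; rewrite (fd_w D2).
  have aL : (ks a < nL)%N by apply: ks_lt; lia.
  by rewrite /lap_entry /lap_term !nrmE ?c1_lt ?c2_lt.
- move=> p hp; rewrite o5 O4 (fd_offD D3) // (negPf hp).
  by rewrite G2.
Qed.

Lemma emitted_ext i st st' : (i <= m)%N ->
  (forall p, (offD i <= p < offD i + (n0 + i) * (n0 + i))%N ->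
     rmem st' 3 p = rmem st 3 p) ->
  emitted i st -> emitted i st'.
Proof.
move=> im h [lab [x [P [lab_le hO]]]]; exists lab, x; split=> //; split=> // a b ha hb.
by rewrite -hO // h // -addnA leq_addr ltn_add2l; nia.
Qed.

Lemma stages_spec st0 : fixed_data st0 -> current m st0 ->
  runs stages st0 (m.+2 * (stage_cost + 40)) (fun st =>
    forall i, (i <= m)%N -> emitted i st).
Proof.
move=> D P.
pose I s st := ((s <= m)%N -> current (m - s) st) /\
  forall i, (i <= m)%N -> (m < i + s)%N -> emitted i st.
have [sm _ _ _] := fd_sizes D.
apply: (runs_weaken (runs_for (cc := stage_cost) (n := m.+1) (I := I) _ _ _ _)).
- by [].
- by move=> st [F _]; rewrite /= F // sm addn1.
- by split=> [_|i im]; [rewrite subn0; exact: P | rewrite addn0; lia].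
- move=> s st sL F es [I1 I2]; rewrite ltnS in sL.
  have D1 := fixed_frame D F isT isT.
  apply: (runs_weaken (stage_spec (i := (m - s)%N) (s := s) _ es D1 (I1 sL))) => //.
    by rewrite subnK.
  move=> st' [C1 C2 C3]; split=> [hs|i im hi].
    have -> : (m - s.+1 = (m - s).-1)%N by lia.
    by apply: C1; lia.
  case: (eqVneq i (m - s)%N) => [->|ne]; first exact: C2.
  apply: (emitted_ext (st := st)) => //; last by apply: I2 => //; lia.
  move=> p hp; apply: C3.
  have := @offD_mono (m - s) i ltac:(lia) im; lia.
- by apply: leq_mul => //=; lia.
- by move=> st [_ h] i im; apply: h => //; lia.
Qed.

End Main.
End Merging.

(** * The whole program *)

Section Whole.
Variables (R : realType) (m n0 nL nL1 : nat).
Implicit Types st : state R.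
Local Notation sizes_in := (@sizes_in R m n0 nL nL1).
Let n := nL1.+1.

(** The cells outside the input arrays are 0. *)
Definition blank st : Prop :=
  (forall a i, (3 < a)%N -> imem st a i = 0%N) /\
  (forall a i, (2 < a)%N -> rmem st a i = 0).

Lemma sizes_frame c st st' : sizes_in st -> frame c st st' ->
  0%N \notin iwrites c -> sizes_in st'.
Proof. by move=> [h1 h2 h3 h4] [F _] h; split; rewrite F. Qed.

Section HalfEdges.
Variables (st0 st : state R).
Let c1 := imem st0 aC1.
Let c2 := imem st0 aC2.
Let v1 := rmem st0 rV1.
Let v2 := rmem st0 rV2.
Let S : pred nat := [pred r | imem st0 aMARK r == 0%N].
Let act := links st0.
Let src := imem st aSRC.
Let tgt := imem st aTGT.
Let rat := rmem st rRAT.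

Hypothesis c1_lt : forall r, (r < nL)%N -> (c1 r < n)%N.
Hypothesis c2_lt : forall r, (r < nL)%N -> (c2 r < n)%N.
Hypothesis edges : forall r, (r < nL)%N -> half_edges_built st0 st r.

Let edgeP r (rL : (r < nL)%N) :
    [/\ src (r + r)%N = if act r then (c1 r).+1 else 0%N,
        src (r + r).+1 = if act r then (c2 r).+1 else 0%N &
        act r ->
        [/\ tgt (r + r)%N = c2 r, rat (r + r)%N = 0 - v1 r / v2 r,
            tgt (r + r).+1 = c1 r & rat (r + r).+1 = 0 - v2 r / v1 r]] :=
  edges rL.

Lemma half_edge_cases g : (g < nL + nL)%N -> src g != 0%N ->
  exists r, [/\ (r < nL)%N, act r &
    g = (r + r)%N \/ g = (r + r).+1].
Proof.
move=> gH sg; have gE := odd_double_half g; rewrite -addnn in gE.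
have rL : (g./2 < nL)%N by lia.
exists g./2; have [e1 e2 _] := edgeP rL.
case: (odd g) gE => /= gE; split=> //; try by [left | right];
  by move: sg; rewrite -{1}gE ?add0n ?add1n ?e1 ?e2; case: ifP.
Qed.

Lemma half_edge_src_le g : (g < nL + nL)%N -> (src g <= n)%N.
Proof.
move=> gH; case: (posnP (src g)) => [->//|]; rewrite lt0n => sg.
have [r [rL ar [gE|gE]]] := half_edge_cases gH sg; have [e1 e2 _] := edgeP rL.
  by rewrite gE e1 ar; apply: c1_lt.
by rewrite gE e2 ar; apply: c2_lt.
Qed.

Lemma half_edge_tgt_lt g : (g < nL + nL)%N -> src g != 0%N -> (tgt g < n)%N.
Proof.
move=> gH sg; have [r [rL ar [gE|gE]]] := half_edge_cases gH sg;
have [_ _ /(_ ar) [t1 _ t2 _]] := edgeP rL.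
  by rewrite gE t1; apply: c2_lt.
by rewrite gE t2; apply: c1_lt.
Qed.

Lemma half_edge_reversible g : (g < nL + nL)%N -> src g != 0%N ->
  exists g', [/\ (g' < nL + nL)%N, src g' = (tgt g).+1 & tgt g' = (src g).-1].
Proof.
move=> gH sg; have [r [rL ar [gE|gE]]] := half_edge_cases gH sg;
have [e1 e2 /(_ ar) [t1 _ t2 _]] := edgeP rL; rewrite ar in e1 e2.
  by exists (r + r).+1; rewrite gE e1 e2 t1 t2; split=> //; lia.
by exists (r + r)%N; rewrite gE e1 e2 t1 t2; split=> //; lia.
Qed.

(** Rows with a single nonzero entry give no half-edge, so this is only an
    implication; they are accounted for by the pass over violated rows. *)
Lemma ker_respects c : ker nL c1 c2 v1 v2 S c -> respects (nL + nL) src tgt rat c.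
Proof.
move=> kc g gH sg; have [r [rL ar gE]] := half_edge_cases gH sg.
have [e1 e2 /(_ ar) [t1 q1 t2 q2]] := edgeP rL; rewrite ar in e1 e2.
have [Sr n1 n2] : [/\ S r, v1 r != 0 & v2 r != 0] by apply/and3P.
have := kc r rL Sr; rewrite /row_val => h0.
have e12 : v2 r * c (c2 r) = - (v1 r * c (c1 r)) by apply/eqP; rewrite -addr_eq0 addrC h0.
case: gE => ->; rewrite ?t1 ?t2 ?q1 ?q2 ?e1 ?e2 sub0r /= mulNr.
  by apply: (mulfI n2); rewrite e12; field.
by apply: (mulfI n1); rewrite mulrN mulrCA mulrA divfK // e12 opprK.
Qed.

Lemma label_rows lab : 
  (forall g, (g < nL + nL)%N -> src g != 0%N -> lab (tgt g) = lab (src g).-1) ->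
  forall r, (r < nL)%N -> S r -> v1 r != 0 -> v2 r != 0 ->
  lab (c1 r) = lab (c2 r) :> nat.
Proof.
move=> h r rL Sr n1 n2; have [e1 _ t] := edgeP rL.
have ar : act r by apply/and3P.
have [t1 _ _ _] := t ar; rewrite ar in e1.
by rewrite -t1 h ?e1 //; lia.
Qed.

End HalfEdges.

(** The factor 4 accounts for the rounds of the search: each column is tried as
    a root and dequeued, and each row has two half-edges. *)
Definition prog_constant :=
  (ccost load_row + ccost half_edge_pair + 4 * ccost search_step + ccost emit_entry
   + ccost merge_setup + 3000)%N.

Definition prog_size :=
  (m.+2 * ((n0 + m).+1 * (n0 + m).+1 + nL1.+3) + nL.+1)%N.

Lemma prog_spec st0 : sizes_in st0 -> blank st0 ->
  (forall r, (r < nL)%N -> (imem st0 1 r < imem st0 1 r.+1)%N ->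
     (imem st0 2 (imem st0 1 r) < nL1)%N) ->
  (forall r, (r < nL)%N -> ((imem st0 1 r).+1 < imem st0 1 r.+1)%N ->
     (imem st0 2 (imem st0 1 r).+1 < nL1)%N) ->
  (forall j, (j < n0 + m)%N -> (imem st0 3 j < nL)%N) ->
  (forall j j', (j < n0 + m)%N -> (j' < n0 + m)%N ->
     imem st0 3 j = imem st0 3 j' -> j = j') ->
  runs laplacians_prog st0 (prog_size * prog_constant) (fun st =>
    exists c1 c2 v1 v2,
    (forall r, (r < nL)%N ->
      row_slots nL1 st0 c1 c2 v1 v2 r) /\
    forall i, (i <= m)%N -> 
      emitted n0 nL nL1 (imem st0 3) c1 c2
       (fun i => \sum_(k < i) (n0 + k) ^ 2)%N (fun i => \sum_(k < i) (n0 + k))%N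
       v1 v2 (rmem st0 2) (rmem st0 1) i st).
Proof.
move=> Z [B1 B2] col1 col2 ks_lt ks_inj.
pose K1 := (ccost load_row + 20)%N; pose K2 := (ccost half_edge_pair + 20)%N.
pose K3 := (ccost search_step + 20)%N; pose H := (nL + nL)%N.
have T : (ccost (set_var vN (succ size_nL1)) + (nL.+1 * K1 + ((m + n0).+1 * 60 +
  (nL.+1 * K2 + (H.+1 * 60 + ((n + n + H).+1 * K3 + (nL.+1 * 120 +
  (n.+1 * 50 + (m.+2 * ((n0 + m).+1 * 120) +
   m.+2 * (stage_cost m n0 nL1 + 40)))))))))
  <= prog_size * prog_constant)%N.
  rewrite [ccost (set_var _ _)]/= /stage_cost /prog_constant /K1 /K2 /K3.
  move: (ccost load_row) (ccost half_edge_pair) (ccost search_step) => k1 k2 k3.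
  move: (ccost emit_entry) (ccost merge_setup) => k4 k5.
  have h1 : (nL.+1 <= prog_size)%N by rewrite /prog_size; lia.
  have h2 : (m.+2 * (n0 + m).+1 <= prog_size)%N by rewrite /prog_size; nia.
  have h3 : ((n0 + m).+1 <= prog_size)%N by apply: leq_trans h2; nia.
  have h4 : (n <= prog_size)%N by rewrite /prog_size /n; nia.
  have h5 : (m.+2 * ((n0 + m).+1 * (n0 + m).+1 + nL1.+3) <= prog_size)%N.
    by rewrite /prog_size leq_addr.
  have h6 : (m.+2 <= prog_size)%N by apply: leq_trans h2; nia.
  rewrite [(m + n0)%N]addnC.
  rewrite [(m.+2 * (_ + 40))%N]mulnDr [(m.+2 * (_ * (_ + 400)))%N]mulnA.
  move: {h1 h2 h3 h4 h5 h6} (h1, h2, h3, h4, h5, h6).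
  rewrite [(m.+2 * ((n0 + m).+1 * 120))%N]mulnA.
  move: prog_size (m.+2 * (n0 + m).+1)%N => W A.
  move: n m.+2 (n0 + m).+1 (m.+2 * (_ + nL1.+3))%N => E D C B.
  move=> [[[[[h1 h2] h3] h4] h5] h6].
  have e1 := leq_mul h1 (leqnn (k1 + 20 + (k2 + 20) + 120)%N).
  have e2 : (H.+1 <= W * 2)%N by rewrite /H; lia.
  have e3 : ((E + E + H).+1 <= W * 4)%N by rewrite /H; lia.
  have e4 := leq_mul e3 (leqnn (k3 + 20)%N).
  have e5 := leq_mul h5 (leqnn (k4 + k5 + 400)%N).
  have e6 : (H.+1 * 60 <= W * 120)%N by rewrite /H; lia.
  move: {e3 h5} (nL.+1) (n + n)%N e1 e2 e4 e5 e6 h1 h2 h3 h4 h6; clearbody H.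
  move=> X Y; lia.
apply: (runs_straight_seq _ T) => // F0; set s0 := ceval _ st0 in F0 *.
have [G0 Q0] := F0.
have Z0 := sizes_frame Z F0 isT.
have N0 : imem s0 vN 0 = n.
  by have [_ _ _ h] := Z; rewrite /s0 /= /update /= h addn1.
clearbody s0.
have E1 : forall a i, a \in [:: 0; 1; 2; 3]%N -> imem s0 a i = imem st0 a i.
  by move=> a i; enum_cells; apply: G0.
apply: (runs_seq (load_rows_spec Z0 _ _)) => [r|r|s1 L1 F1].
- by rewrite Q0 // B2.
- by rewrite Q0 // B2.
have [G1 Q1] := F1; have Z1 := sizes_frame Z0 F1 isT.
pose c1 := imem s1 aC1; pose c2 := imem s1 aC2.
pose v1 := rmem s1 rV1; pose v2 := rmem s1 rV2.
have rowsP r : (r < nL)%N ->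
      row_slots nL1 st0 c1 c2 v1 v2 r.
  move=> rL; have := L1 r rL; rewrite /row_loaded /row_slots /= !E1 // !Q0 //; exact.
have c1_lt r : (r < nL)%N -> (c1 r < n)%N.
  move=> rL; have [-> _ _ _] := rowsP r rL.
  by case: ifP => // h; apply: ltnW; rewrite ltnS; apply: col1.
have c2_lt r : (r < nL)%N -> (c2 r < n)%N.
  move=> rL; have [_ _ -> _] := rowsP r rL.
  by case: ifP => // h; apply: ltnW; rewrite ltnS; apply: col2.
apply: (runs_seq (mark_rows_spec Z1 _)) => [r|s2 M2 F2].
  by rewrite G1 // G0 // B1.
have [G2 Q2] := F2; have Z2 := sizes_frame Z1 F2 isT.
apply: (runs_seq (half_edges_spec Z2 _)) => [r|s3 L3 F3].
  by rewrite G2 // G1 // G0 // B1.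
have [G3 Q3] := F3; have Z3 := sizes_frame Z2 F3 isT.
apply: (runs_seq (link_half_edges_spec Z3 _)) => [r|s4 [L4 L4'] F4].
  by rewrite G3 // G2 // G1 // G0 // B1.
have [G4 Q4] := F4; have Z4 := sizes_frame Z3 F4 isT.
have c1_lt2 r : (r < nL)%N -> (imem s2 aC1 r < n)%N by rewrite G2 //; apply: c1_lt.
have c2_lt2 r : (r < nL)%N -> (imem s2 aC2 r < n)%N by rewrite G2 //; apply: c2_lt.
pose src := imem s3 aSRC; pose tgt := imem s3 aTGT; pose rat := rmem s3 rRAT.
(* The search graph as built in [s3]; linking does not change it. *)
have SI : search_input n H src tgt rat s4.
  split.
  - by rewrite G4 // G3 // G2 // G1.
  - by move=> g _ _; rewrite G4.
  - by move=> g _ _; rewrite Q4.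
  - by move=> g gH _; apply: L4'.
  - by move=> t _; apply: L4.
apply: (runs_seq (search_spec (half_edge_src_le c1_lt2 c2_lt2 L3)
  (half_edge_tgt_lt c1_lt2 c2_lt2 L3) (half_edge_reversible L3) SI _ _)).
- by move=> t; rewrite G4 // G3 // G2 // G1 // G0 // B1.
- by split; rewrite G4 // G3 // G2 // G1 // G0 // B1.
move=> s5 [X5 L5] F5; have [G5 Q5] := F5; have Z5 := sizes_frame Z4 F5 isT.
have i5 a i : a \in [:: aC1; aC2; aMARK] -> imem s5 a i = imem s2 a i.
  by enum_cells; rewrite G5 // G4 // G3.
have r5 a i : a \in [:: rV1; rV2] -> rmem s5 a i = rmem s2 a i.
  by enum_cells; rewrite Q5 // Q4 // Q3.
have ker5 c : ker nL (imem s5 aC1) (imem s5 aC2) (rmem s5 rV1) (rmem s5 rV2)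
    (fun r => imem s5 aMARK r == 0%N) c -> respects H src tgt rat c.
  move=> kc; apply: (ker_respects L3) => r rL /= Sr.
  have := kc r rL; rewrite /row_val !i5 // !r5 // => h; exact: h.
have c1_lt5 r : (r < nL)%N -> (imem s5 aC1 r < n)%N.
  by move=> rL; rewrite i5 //; apply: c1_lt2.
have c2_lt5 r : (r < nL)%N -> (imem s5 aC2 r < n)%N.
  by move=> rL; rewrite i5 //; apply: c2_lt2.
have xP5 t c : (t < n)%N ->
    ker nL (imem s5 aC1) (imem s5 aC2) (rmem s5 rV1) (rmem s5 rV2)
      (fun r => imem s5 aMARK r == 0%N) c ->
    c t = c (imem s5 aLAB t).-1 * rmem s5 rX t.
  by move=> tn /ker5 kc; have [_] := X5 t tn; apply.
have labP5 r : (r < nL)%N -> imem s5 aMARK r == 0%N ->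
    rmem s5 rV1 r != 0 -> rmem s5 rV2 r != 0 ->
    imem s5 aLAB (imem s5 aC1 r) = imem s5 aLAB (imem s5 aC2 r).
  move=> rL Sr n1 n2; rewrite (i5 aC1) // (i5 aC2) //.
  by apply: (label_rows L3 L5) => //=; rewrite -?i5 -?r5.
apply: (runs_seq (check_rows_spec Z5 _ c1_lt5 c2_lt5 xP5 labP5)).
  by move=> l; rewrite G5 // G4 // G3 // G2 // G1 // G0 // B1.
move=> s6 [bad6 resp6] F6; have [G6 Q6] := F6; have Z6 := sizes_frame Z5 F6 isT.
have N6 : imem s6 vN 0 = n.
  by rewrite G6 // G5 // G4 // G3 // G2 // G1.
apply: (runs_seq (kill_bad_spec N6)) => s7 X7 F7.
have [G7 Q7] := F7; have Z7 := sizes_frame Z6 F7 isT.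
apply: (runs_seq (offsets_spec Z7 _ _)).
- by rewrite G7 // G6 // G5 // G4 // G3 // G2 // G1 // G0 // B1.
- by rewrite G7 // G6 // G5 // G4 // G3 // G2 // G1 // G0 // B1.
move=> s8 O8 F8; have [G8 Q8] := F8; have Z8 := sizes_frame Z7 F8 isT.
have i8 a i : a \in [:: aC1; aC2] -> imem s8 a i = imem s1 a i.
  by enum_cells; rewrite G8 // G7 // G6 // i5 // G2.
have r8 a i : a \in [:: rV1; rV2] -> rmem s8 a i = rmem s1 a i.
  by enum_cells; rewrite Q8 // Q7 // Q6 // r5 // Q2.
have ks8 i : imem s8 3 i = imem st0 3 i.
  by rewrite G8 // G7 // G6 // G5 // G4 // G3 // G2 // G1 // G0.
have D8 : fixed_data m n0 nL nL1 (imem st0 3) c1 c2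
  (fun i => \sum_(k < i) (n0 + k) ^ 2)%N (fun i => \sum_(k < i) (n0 + k))%N
  v1 v2 (rmem st0 2) (rmem st0 1) s8.
  split=> //.
  - by rewrite G8 // G7.
  - by move=> i; rewrite i8.
  - by move=> i; rewrite i8.
  - by move=> i /O8[].
  - by move=> i /O8[].
  - by move=> i; rewrite r8.
  - by move=> i; rewrite r8.
  - by move=> i; rewrite Q8 // Q7 // Q6 // Q5 // Q4 // Q3 // Q2 // Q1 // Q0.
  - by move=> i; rewrite Q8 // Q7 // Q6 // Q5 // Q4 // Q3 // Q2 // Q1 // Q0.
have C8 : current n0 nL nL1 (imem st0 3) c1 c2 v1 v2 m s8.
  split; last first.
    by move=> t tn; rewrite G8 // G7 // G6 //; have [/andP[]] := X5 t tn.
  have ks1 j : imem s1 3 j = imem st0 3 j by rewrite G1 // G0.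
  have SE r : (imem s5 aMARK r == 0%N) = removed n0 (imem st0 3) m r.
    rewrite i5 // -[LHS]negbK M2 addnC /removed /=; congr (_ \notin _).
    by apply: eq_map => j; apply: ks1.
  have kerE c : ker nL c1 c2 v1 v2 (removed n0 (imem st0 3) m) c <->
      ker nL (imem s5 aC1) (imem s5 aC2) (rmem s5 rV1) (rmem s5 rV2)
        (fun r => imem s5 aMARK r == 0%N) c.
    have rowE r : row_val (imem s5 aC1) (imem s5 aC2) (rmem s5 rV1) (rmem s5 rV2) c r
        = row_val c1 c2 v1 v2 c r.
      rewrite /row_val (i5 aC1) // (i5 aC2) // (r5 rV1) // (r5 rV2) //.
      by rewrite !G2 // !Q2.
    by split=> kc r rL; [rewrite SE rowE | rewrite -SE -rowE]; apply: kc.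
  have x8 t : (t < n)%N -> rmem s8 rX t =
      if imem s6 aBAD (imem s5 aLAB t) != 0%N then 0 else rmem s5 rX t.
    by move=> tn; rewrite Q8 // X7 // (G6 aLAB) // Q6.
  have l8 t : imem s8 aLAB t = imem s5 aLAB t by rewrite G8 // G7 // G6.
  move=> c; apply: (iff_trans (kerE c)).
  apply: (iff_trans (param_potentials
    (bad := fun l => imem s6 aBAD l != 0%N) c1_lt5 c2_lt5 xP5 labP5 bad6 resp6 c)).
  by split=> -[y hy]; exists y => t tn; rewrite hy // l8 x8.
(* The stages begin with the potentials for K_m. *)
have S8 := stages_spec c1_lt c2_lt ks_lt ks_inj _ D8 C8.
apply: (runs_weaken (S8 _)) => // [i im|st h].
  by rewrite big_ord_recr /= mulnn.
by exists c1, c2, v1, v2.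
Qed.
End Whole.

(** * Rows of the boundary matrix *)

Section Rows.
Variables (R : realType).

(** With at most two nonzero entries, a row is a combination of two coordinate
    functions, read off the first two stored entries. *)
Lemma csr_row k (row : 'I_k -> R) (col : nat -> nat) (v : nat -> R) p p' :
  (p <= p')%N ->
  perm_eq [seq (col l, v l) | l <- index_iota p p']
          [seq (val j, row j) | j <- enum 'I_k & row j != 0] ->
  (size [seq j <- enum 'I_k | row j != 0%R] <= 2)%N ->
  [/\ (p < p')%N -> (col p < k)%N, (p.+1 < p')%N -> (col p.+1 < k)%N &
    forall F : nat -> R, \sum_(j < k) F j * row j =
      (if (p < p')%N then v p else 0) * F (if (p < p')%N then col p else k) +
      (if (p.+1 < p')%N then v p.+1 else 0)
        * F (if (p.+1 < p')%N then col p.+1 else k)].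
Proof.
move=> pp' pe sz.
have col_lt l : (p <= l < p')%N -> (col l < k)%N.
  move=> hl; have : (col l, v l) \in [seq (col l, v l) | l <- index_iota p p'].
    by apply: (map_f (fun l => (col l, v l))); rewrite mem_index_iota.
  by rewrite (perm_mem pe) => /mapP[j _ [-> _]].
split=> [h|h|F]; [by apply: col_lt; lia | by apply: col_lt; lia |].
have -> : \sum_(j < k) F j * row j = \sum_(l <- index_iota p p') v l * F (col l).
  transitivity (\sum_(z <- [seq (val j, row j) | j <- enum 'I_k & row j != 0])
     z.2 * F z.1).
    rewrite big_map big_filter big_enum_cond /= [RHS]big_mkcond /=.
    apply: eq_bigr => j _; rewrite mulrC.
    by case: eqP => [->|_] //=; rewrite mul0r.
  by rewrite -(perm_big _ pe) big_map.
move: sz; rewrite -(size_map (fun j => (val j, row j))) -(perm_size pe).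
rewrite size_map size_iota => sz.
have [d [dle ->]] : exists d, (d <= 2)%N /\ p' = (d + p)%N.
  by exists (p' - p)%N; rewrite subnK.
rewrite /index_iota addnK; case: d dle => [|[|[|//]]] _ /=.
- by rewrite big_nil add0n ltnn ltnNge leqnSn !mul0r addr0.
- by rewrite big_seq1 add1n ltnSn ltnn mul0r addr0.
- by rewrite !big_cons big_nil addr0 add2n ltnSn leqnSn.
Qed.

Variable V : finType.
Implicit Types (s t : {set V}) (L K : {set {set V}}).

(** A nonzero incidence coefficient comes from the vertex list of [t] with one
    vertex left out. *)
Lemma boundary_coef_face (o : {set V} -> seq V) t s :
  perm_eq (o t) (enum t) -> boundary_coef R o t s != 0 ->
  s \subset t /\ #|s|.+1 = #|t|.
Proof.
move=> po nz.
have uo : uniq (o t) by rewrite (perm_uniq po) enum_uniq.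
have [i hi] : exists i : 'I_(size (o t)),
    oriented_coef R o (take i (o t) ++ drop i.+1 (o t)) s != 0.
  apply/existsP; apply: contraNT nz; rewrite negb_exists => /forallP h.
  by rewrite /boundary_coef big1 // => i _; have := h i; rewrite negbK => /eqP->; rewrite mulr0.
have es : s = [set x in take i (o t) ++ drop i.+1 (o t)].
  by apply/eqP; apply: contraNT hi => h; rewrite /oriented_coef (negPf h).
have sub : subseq (take i (o t) ++ drop i.+1 (o t)) (o t).
  rewrite -[X in subseq _ X](cat_take_drop i) cat_subseq ?subseq_refl //.
  by rewrite -add1n -drop_drop drop_subseq.
split.
  apply/subsetP => x; rewrite es inE => /(mem_subseq sub).
  by rewrite (perm_mem po) mem_enum.
rewrite es cardsE (card_uniqP (subseq_uniq sub uo)) size_cat size_take size_drop.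
rewrite ltn_ord [in RHS]cardE -(perm_size po) -addnS subnSK //.
by rewrite subnKC // ltnW.
Qed.

Section Complex.
Variables (q : nat) (L : {set {set V}}) (o : {set V} -> seq V).
Variables (Lq Lq1 : seq {set V}).
Hypothesis L_complex : simplicial_complex L.
Hypothesis L_oriented : orientation L o.
Hypothesis LqP : perm_eq Lq (enum (simplices q L)).
Hypothesis Lq1P : perm_eq Lq1 (enum (simplices q.+1 L)).

Lemma mem_Lq s : (s \in Lq) = (s \in simplices q L).
Proof. by rewrite (perm_mem LqP) mem_enum. Qed.

Lemma mem_Lq1 s : (s \in Lq1) = (s \in simplices q.+1 L).
Proof. by rewrite (perm_mem Lq1P) mem_enum. Qed.

Lemma size_Lq : size Lq = nsimplices q L.
Proof. by rewrite (perm_size LqP) -cardE. Qed.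

Lemma size_Lq1 : size Lq1 = nsimplices q.+1 L.
Proof. by rewrite (perm_size Lq1P) -cardE. Qed.

(** Boundaries of simplices of L stay in L, because L is closed under faces. *)
Lemma boundary_coef_out t s : t \in simplices q.+1 L ->
  s \notin simplices q L -> boundary_coef R o t s = 0.
Proof.
rewrite !inE => /andP[tL /eqP st] ns; apply/eqP; apply: contraNT ns => nz.
have [sub card] := boundary_coef_face (L_oriented tL) nz.
have cs : #|s| == q.+1 by rewrite -eqSS card st.
rewrite cs andbT; apply: (L_complex.2 _ _ tL sub).
by rewrite -card_gt0 (eqP cs).
Qed.

(** Distinct nonzero entries of a row are distinct cofaces of its simplex. *)
Lemma row_nonzeros (r : 'I_(size Lq)) : non_branching q L ->
  (size [seq j <- enum 'I_(size Lq1) | boundary_matrix R o Lq Lq1 r j != 0%R] <= 2)%N.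
Proof.
move=> nb; have rL : nth set0 Lq r \in simplices q L by rewrite -mem_Lq mem_nth.
apply: leq_trans (nb _ rL); rewrite cardE.
rewrite -(size_map (fun j : 'I_(size Lq1) => nth set0 Lq1 j)).
apply: uniq_leq_size.
  rewrite map_inj_in_uniq => [|i j _ _ e]; first exact: filter_uniq (enum_uniq _).
  apply: val_inj; apply/eqP; rewrite -(nth_uniq set0 (ltn_ord i) (ltn_ord j)) ?e //.
  by rewrite (perm_uniq Lq1P) enum_uniq.
move=> t /mapP[j]; rewrite mem_filter mxE => /andP[nz _] ->.
have tL : nth set0 Lq1 j \in simplices q.+1 L by rewrite -mem_Lq1 mem_nth.
rewrite mem_enum inE tL /=; move: tL; rewrite inE => /andP[tL _].
by have [] := boundary_coef_face (L_oriented tL) nz.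
Qed.

Lemma sum_simplices (F : {set V} -> R) :
  \sum_(t in simplices q.+1 L) F t = \sum_(j < size Lq1) F (nth set0 Lq1 j).
Proof.
rewrite -big_enum -(perm_big _ Lq1P) (big_nth set0) big_mkord //.
Qed.

Lemma boundaryE (c : chain R V) s :
  boundary o q.+1 L c s =
  \sum_(j < size Lq1) c (nth set0 Lq1 j) * boundary_coef R o (nth set0 Lq1 j) s.
Proof. by rewrite ffunE sum_simplices. Qed.

End Complex.
End Rows.

(** * The Laplacian of a parametrized kernel *)

Lemma label_sum (R : realType) k B (lab : nat -> nat) (h a : nat -> R) :
  (forall j, (j < k)%N -> (lab j < B)%N) ->
  \sum_(j < k) h (lab j) * a j =
  \sum_(l < B) h l * \sum_(j < k | lab j == l) a j.
Proof.
move=> lab_lt; under [RHS]eq_bigr do rewrite big_distrr big_mkcond /=.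
rewrite exchange_big; apply: eq_bigr => j _ /=.
rewrite -big_mkcond (big_pred1 (Ordinal (lab_lt j (ltn_ord j)))) // => l.
Qed.

Section Laplacian.
Variables (R : realType) (V : finType) (q : nat) (K L : {set {set V}}).
Variables (o : {set V} -> seq V) (wK wL : {set V} -> R).
Variables (Lq Lq1 : seq {set V}).
Hypothesis K_sub : K \subset L.
Hypothesis L_complex : simplicial_complex L.
Hypothesis L_oriented : orientation L o.
Hypothesis LqP : perm_eq Lq (enum (simplices q L)).
Hypothesis Lq1P : perm_eq Lq1 (enum (simplices q.+1 L)).
Hypothesis wL_gt0 : forall s, s \in L -> 0 < wL s.

Let nL1 := size Lq1.
Let face r := nth set0 Lq r.
Let cell j := nth set0 Lq1 j.

Variables (c1 c2 : nat -> nat) (v1 v2 : nat -> R).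
Hypothesis rowP : forall r, (r < size Lq)%N -> forall F : nat -> R,
  \sum_(j < nL1) F j * boundary_coef R o (cell j) (face r) =
  row_val c1 c2 v1 v2 F r.

Variables (S : pred nat) (lab : nat -> nat) (x w : nat -> R).
Hypothesis SE : forall r, (r < size Lq)%N -> S r = (face r \notin simplices q K).
Hypothesis xP : param nL1.+1 (size Lq) c1 c2 v1 v2 S lab x.
Hypothesis lab_le : forall t, (t < nL1.+1)%N -> (lab t <= nL1.+1)%N.
Hypothesis wE : forall j, (j < nL1)%N -> w j = wL (cell j).
Hypothesis w_last : w nL1 = 0.

Let N := norm_sum nL1.+1 lab x w.

Lemma cell_in j : (j < nL1)%N -> cell j \in simplices q.+1 L.
Proof. by move=> jn; rewrite -(mem_Lq1 Lq1P) mem_nth. Qed.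

Lemma index_cell j : (j < nL1)%N -> index (cell j) Lq1 = j.
Proof. by move=> jn; rewrite index_uniq // (perm_uniq Lq1P) enum_uniq. Qed.

(** The extra column has weight 0, and division by 0 gives 0, so it does not
    contribute to the norms. *)
Lemma normE l : N l = \sum_(j < nL1 | lab j == l) x j * x j / w j.
Proof.
rewrite /N /norm_sum big_mkcond big_ord_recr -big_mkcond /= w_last invr0 mulr0.
by rewrite if_same addr0.
Qed.

Lemma w_gt0 j : (j < nL1)%N -> 0 < w j.
Proof.
move=> jn; rewrite wE //; apply: wL_gt0.
by have := cell_in jn; rewrite inE => /andP[].
Qed.

(** The quotient by the norm in the adjoint is thus correct also on annihilated
    components, where both numerator and denominator are 0. *)
Lemma norm0_zero l j : N l = 0 -> (j < nL1)%N -> lab j = l -> x j = 0.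
Proof.
move=> /eqP; rewrite normE psumr_eq0 => [/allP h jn lj|i _]; last first.
  by rewrite -expr2 divr_ge0 ?sqr_ge0 // ltW // w_gt0.
have := h (Ordinal jn) (mem_index_enum _); rewrite /= lj eqxx /=.
rewrite mulf_eq0 invr_eq0 (gt_eqF (w_gt0 jn)) orbF -expr2 sqrf_eq0.
by move/eqP.
Qed.

(** The rows of L outside K are the only constraints: a boundary has no
    coefficient outside L. *)
Lemma ker_rel_chains c : in_chains q.+1 L c ->
  in_rel_chains o q K L c <-> ker (size Lq) c1 c2 v1 v2 S (c \o cell).
Proof.
move=> cL; split=> [[_ h] r rL Sr | h].
  have := h (face r); rewrite -SE // (boundaryE o Lq1P) => /(_ Sr) e.
  by rewrite -rowP.
split=> // s sK; have [sL|sL] := boolP (s \in simplices q L); last first.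
  rewrite ffunE big1 // => t tL.
  by rewrite (boundary_coef_out R L_complex L_oriented tL sL) mulr0.
have sLq : s \in Lq by rewrite (mem_Lq LqP).
have rL : (index s Lq < size Lq)%N by rewrite index_mem.
have es : face (index s Lq) = s by rewrite /face nth_index.
rewrite (boundaryE o Lq1P) -{1}es (rowP rL (c \o cell)).
by apply: h; rewrite // SE // es.
Qed.

(** Coefficient of the cochain that pairs a (q+1)-chain with [d] by means of
    the inner product of its boundary. *)
Definition codiff (d : chain R V) j : R :=
  \sum_(s in simplices q K) boundary_coef R o (cell j) s * ((wK s)^-1 * d s).

Definition class_sum (d : chain R V) l : R :=
  \sum_(j < nL1 | lab j == l) x j * codiff d j.

(** The component labelled [l] carries a basis chain; its coefficient in the
    adjoint is the inner product of [d] with the boundary of that chain, divided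
    by the squared norm of the chain. *)
Definition adjoint (d : chain R V) : chain R V :=
  [ffun t => if t \in simplices q.+1 L then
     x (index t Lq1) * (class_sum d (lab (index t Lq1)) / N (lab (index t Lq1)))
   else 0].

Lemma adjoint_cell d j : (j < nL1)%N ->
  adjoint d (cell j) = x j * (class_sum d (lab j) / N (lab j)).
Proof. by move=> jn; rewrite ffunE cell_in // index_cell. Qed.

Lemma adjoint_rel_chains d : in_rel_chains o q K L (adjoint d).
Proof.
apply/ker_rel_chains; first by move=> t /negPf tL; rewrite ffunE tL.
(* [c] may differ from the adjoint at the extra column, where no row has a
   nonzero entry. *)
pose c t := class_sum d (lab t) / N (lab t) * x t.
have kc : ker (size Lq) c1 c2 v1 v2 S c.
  by apply: (xP c).2; exists (fun l => class_sum d l / N l).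
move=> r rL Sr; rewrite -(kc r rL Sr) -!rowP //.
by apply: eq_bigr => j _; rewrite /= adjoint_cell // mulrC [c j]mulrC mulrC.
Qed.

(** Both inner products are sums over components of [y] times the class sum:
    on the right the squared norm of the potential cancels the denominator. *)
Lemma adjointP : boundary_adjoint o q K L wK wL adjoint.
Proof.
split=> [d _|c d cR dK]; first exact: adjoint_rel_chains.
have [cL _] := cR; have /xP[y hy] := (ker_rel_chains cL).1 cR.
have cE j : (j < nL1)%N -> c (cell j) = y (lab j) * x j.
  by move=> jn; apply: (hy j); apply: ltnW.
have lab_lt j : (j < nL1)%N -> (lab j < nL1.+2)%N.
  by move=> jn; rewrite ltnS; apply: lab_le; apply: ltnW.
transitivity (\sum_(j < nL1) y (lab j) * (x j * codiff d j)).
  rewrite /chain_inner; under eq_bigr do rewrite (boundaryE o Lq1P).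
  under eq_bigr do rewrite big_distrl big_distrr /=.
  rewrite exchange_big; apply: eq_bigr => j _ /=.
  rewrite mulrA -cE // /codiff big_distrr; apply: eq_bigr => s _ /=.
  by rewrite /cell; ring.
rewrite (label_sum y (fun j => x j * codiff d j) lab_lt).
rewrite /chain_inner (sum_simplices Lq1P).
transitivity (\sum_(j < nL1) (y (lab j) * (class_sum d (lab j) / N (lab j))) *
                (x j * x j / w j)).
  rewrite (label_sum (fun l => y l * (class_sum d l / N l))
     (fun j => x j * x j / w j) lab_lt).
  apply: eq_bigr => l _; rewrite -normE -mulrA; congr (_ * _).
  have [N0|nz] := eqVneq (N l) 0; last by rewrite divfK.
  rewrite N0 mulr0 big1 // => j /eqP lj.
  by rewrite (norm0_zero N0 (ltn_ord j) lj) mul0r.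
apply: eq_bigr => j _; rewrite -/(cell j) cE // adjoint_cell // wE //; ring.
Qed.

(** A basis chain of K has at most two cofaces, so its class sums, and then the
    boundary of its image under the adjoint, are sums over two slots. *)
Lemma laplacian_entry ra rb :
  (ra < size Lq)%N -> (rb < size Lq)%N -> face rb \in simplices q K ->
  boundary o q.+1 L (adjoint (basis_chain R (face rb))) (face ra) =
  lap_entry c1 c2 v1 v2 lab x N ra rb / wK (face rb).
Proof.
move=> aL bL bK.
have gE j : codiff (basis_chain R (face rb)) j =
    boundary_coef R o (cell j) (face rb) / wK (face rb).
  rewrite /codiff (bigD1 (face rb)) //= ffunE eqxx mulr1 big1 ?addr0 //.
  by move=> s /andP[_ /negPf ne]; rewrite ffunE ne !mulr0.
have cE l : class_sum (basis_chain R (face rb)) l =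
    row_val c1 c2 v1 v2 (fun j => if lab j == l then x j else 0) rb / wK (face rb).
  rewrite /class_sum -rowP // big_distrl big_mkcond; apply: eq_bigr => j _ /=.
  by rewrite gE; case: eqP => _; rewrite ?mul0r // mulrA.
rewrite (boundaryE o Lq1P).
under eq_bigr => j _ do rewrite -/(cell j) adjoint_cell // cE.
rewrite (rowP aL (fun j => x j * (row_val c1 c2 v1 v2
  (fun j0 => if lab j0 == lab j then x j0 else 0) rb / wK (face rb) / N (lab j)))).
rewrite /row_val /lap_entry /lap_term.
have e u u' := eq_sym (lab (u rb)) (lab (u' ra)).
rewrite (e c1 c1) (e c1 c2) (e c2 c1) (e c2 c2).
do 4 case: eqP => _; ring.
Qed.

Lemma laplacian_correct (ks : seq {set V}) k (D : 'M[R]_k) :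
  (forall a, (a < k)%N -> nth set0 ks a \in simplices q K) ->
  (forall a b : 'I_k, D a b =
     lap_entry c1 c2 v1 v2 lab x N (index (nth set0 ks a) Lq)
       (index (nth set0 ks b) Lq) / wK (nth set0 ks b)) ->
  up_laplacian_matrix o q K L wK wL ks D.
Proof.
move=> ksK DE; exists adjoint; first exact: adjointP.
apply/matrixP => a b; rewrite mxE DE.
have inL (a' : 'I_k) : nth set0 ks a' \in Lq.
  rewrite (mem_Lq LqP); have := ksK a' (ltn_ord a'); rewrite !inE.
  by move=> /andP[/(subsetP K_sub) -> ->].
have fE (a' : 'I_k) : face (index (nth set0 ks a') Lq) = nth set0 ks a'.
  by rewrite /face nth_index.
have aL a' : (index (nth set0 ks (a' : 'I_k)) Lq < size Lq)%N by rewrite index_mem.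
have := laplacian_entry (aL a) (aL b); rewrite !fE => -> //.
exact: ksK.
Qed.

End Laplacian.

(** * Assembling the theorem *)

Lemma nth_weights (R : realType) (T : eqType) (n : nat -> nat) (f : nat -> T -> R)
    (ks : seq T) s0 m i b :
  (forall k, (k <= m)%N -> (n k <= size ks)%N) -> (i <= m)%N -> (b < n i)%N ->
  nth 0 (flatten [seq [seq f k s | s <- take (n k) ks] | k <- iota 0 m.+1])
    (\sum_(k < i) n k + b) = f i (nth s0 ks b).
Proof.
move=> hn im bn.
have -> : iota 0 m.+1 = iota 0 i ++ i :: iota i.+1 (m - i).
  by rewrite -[m.+1](_ : (i + (m - i).+1 = _)%N) ?iotaD //; lia.
rewrite map_cat flatten_cat.
have sz : size (flatten [seq [seq f k s | s <- take (n k) ks] | k <- iota 0 i])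
    = (\sum_(k < i) n k)%N.
  rewrite size_flatten /shape -map_comp sumnE big_map.
  rewrite -[i in LHS]subn0 -/(index_iota 0 i) big_mkord; apply: eq_bigr => k _ /=.
  by rewrite size_map size_takel // hn // ltnW // (leq_trans (ltn_ord k)).
rewrite nth_cat sz ltnNge leq_addr /= addKn nth_cat.
rewrite size_map size_takel ?hn // bn.
by rewrite (nth_map s0) ?size_takel ?hn // nth_take.
Qed.

Lemma inverse_ackermann_gt0 k : (0 < inverse_ackermann k)%N.
Proof. by rewrite /inverse_ackermann; case: ex_minnP => j /andP[]. Qed.

(** If K_m has no q-simplices then m = 0; otherwise its number [n0 + m] of
    q-simplices is positive and the lower-order terms are absorbed by its
    square. *)
Lemma prog_size_bound m n0 nL nL1 alpha : (0 < alpha)%N ->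
  (prog_size m n0 nL nL1 <= 20 * maxn 1
    (m.+1 * (n0 + m) ^ 2 + m.+1 * nL1 + (nL - (n0 + m) + m) * alpha))%N.
Proof.
move=> a0; rewrite /prog_size.
set nm := (n0 + m)%N; set bd := (_ + _ * alpha)%N.
have h1 : (nL - nm <= bd)%N by rewrite /bd; nia.
have h2 : (m.+1 * nm ^ 2 + m.+1 * nL1 <= bd)%N by rewrite /bd leq_addr.
have hmn : (m <= nm)%N by rewrite /nm; lia.
case: (posnP nm) => [z|pos].
  have m0 : m = 0%N by lia.
  by rewrite z m0 in h1 h2 *; lia.
have h3 : (nm.+1 * nm.+1 <= 4 * nm ^ 2)%N by rewrite -mulnn; nia.
have h4 : (m.+1 <= m.+1 * nm ^ 2)%N by rewrite leq_pmulr // expn_gt0 pos.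
have h5 : (nm <= m.+1 * nm ^ 2)%N by rewrite -mulnn; nia.
have h6 : (m.+2 * (nm.+1 * nm.+1 + nL1.+3) <=
   2 * m.+1 * (4 * nm ^ 2 + nL1.+3))%N by apply: leq_mul; lia.
apply: leq_trans (_ : _ <= 20 * bd)%N _; last by lia.
move: h6; rewrite mulnDr; nia.
Qed.

Theorem mainTheorem3 (R : realType) :
  exists (prog : cmd) (C : nat),
  forall (V : finType) (q m : nat)
         (K : nat -> {set {set V}}) (L : {set {set V}})
         (o : {set V} -> seq V)
         (wK : nat -> {set V} -> R) (wL : {set V} -> R)
         (Lq Lq1 ks : seq {set V}) (B : csr R),
  (forall i, (i <= m)%N -> simplicial_complex (K i)) ->
  simplicial_complex L ->
  (forall i, (i < m)%N -> K i \subset K i.+1) ->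
  K m \subset L ->
  non_branching q L ->
  (forall i, (i < m)%N ->
     nsimplices q (K i.+1) = (nsimplices q (K i)).+1) ->
  orientation L o ->
  (forall i s, (i <= m)%N -> s \in K i -> 0 < wK i s) ->
  (forall s, s \in L -> 0 < wL s) ->
  perm_eq Lq (enum (simplices q L)) ->
  perm_eq Lq1 (enum (simplices q.+1 L)) ->
  uniq ks ->
  (forall i, (i <= m)%N ->
     take (nsimplices q (K i)) ks =i simplices q (K i)) ->
  size ks = nsimplices q (K m) ->
  csr_represents (boundary_matrix R o Lq Lq1) B ->
  let n i := nsimplices q (K i) in
  let nL := nsimplices q L in
  let nL1 := nsimplices q.+1 L in
  let input :=
    input_state [:: m; n 0%N; nL; nL1] B
      [seq index s Lq | s <- ks]
      (flatten [seq [seq wK i s | s <- take (n i) ks] | i <- iota 0 m.+1])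
      [seq wL t | t <- Lq1] in
  let bound :=
    (m.+1 * n m ^ 2 + m.+1 * nL1
     + (nL - n m + m) * inverse_ackermann nL1)%N in
  exists (t : nat) (final : state R) (D : forall i, 'M[R]_(n i)),
    [/\ exec prog input t final,
        (t <= C * maxn 1 bound)%N,
        (forall i, (i <= m)%N ->
           up_laplacian_matrix o q (K i) L (wK i) wL ks (D i)) &
        outputs m D final].
Proof.
exists laplacians_prog, (20 * prog_constant)%N.
move=> V q m K L o wK wL Lq Lq1 ks B _ hL hK hKL hnb hcard ho _ hwL hLq hLq1.
move=> ks_uniq hks ks_size hB n nL nL1 input bound.
have nE i : (i <= m)%N -> n i = (n 0%N + i)%N.
  elim: i => [|i IH] im; first by rewrite addn0.
  by rewrite /n hcard // -/(n i) IH ?addnS // ltnW.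
set n0 := n 0%N in nE.
have KL i : (i <= m)%N -> K i \subset L.
  move=> im; apply: subset_trans hKL; rewrite -(subnK im).
  have : (m - i + i <= m)%N by rewrite subnK.
  elim: (m - i)%N => // k IH km; apply: subset_trans (IH _) (hK _ _); lia.
have LqE := size_Lq hLq; have Lq1E := size_Lq1 hLq1.
have ks_size' : size ks = (n0 + m)%N by rewrite ks_size -nE.
have ks_in i a : (i <= m)%N -> (a < n i)%N -> nth set0 ks a \in simplices q (K i).
  move=> im an; rewrite -hks // -/(n i) -(nth_take _ an) mem_nth //.
  by rewrite size_takel // ks_size' nE // leq_add2l.
have ks_Lq a : (a < n0 + m)%N -> nth set0 ks a \in Lq.
  move=> an; rewrite (mem_Lq hLq); have := ks_in m a (leqnn m).
  rewrite nE // => /(_ an); rewrite !inE => /andP[/(subsetP hKL) -> ->] //.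
have in_ks a : (a < n0 + m)%N -> imem input 3 a = index (nth set0 ks a) Lq.
  by move=> an; rewrite /= (nth_map set0) // ks_size'.
have ks_inj a b : (a < n0 + m)%N -> (b < n0 + m)%N ->
    imem input 3 a = imem input 3 b -> a = b.
  move=> an bn; rewrite !in_ks // => e.
  apply/eqP; rewrite -(nth_uniq set0 _ _ ks_uniq) ?ks_size' //.
  by rewrite -(nth_index set0 (ks_Lq a an)) e nth_index ?ks_Lq.
have [_ _ _ _ csr_rows] := hB.
have rows (r : 'I_(size Lq)) := csr_row (csr_rows r).1 (csr_rows r).2
  (row_nonzeros R ho hLq hLq1 r hnb).
have sizesP : sizes_in m n0 (size Lq) (size Lq1) input.
  by split=> //; rewrite ?LqE ?Lq1E.
have blankP : blank input.
  by split=> a j; do 4?[case: a => [|a] //=]; rewrite !nth_nil.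
have col1 r : (r < size Lq)%N -> (imem input 1 r < imem input 1 r.+1)%N ->
    (imem input 2 (imem input 1 r) < size Lq1)%N.
  by move=> rL; have [h _ _] := rows (Ordinal rL).
have col2 r : (r < size Lq)%N -> ((imem input 1 r).+1 < imem input 1 r.+1)%N ->
    (imem input 2 (imem input 1 r).+1 < size Lq1)%N.
  by move=> rL; have [_ h _] := rows (Ordinal rL).
have ks_lt a : (a < n0 + m)%N -> (imem input 3 a < size Lq)%N.
  by move=> an; rewrite in_ks // index_mem ks_Lq.
have [t [final [E lt [c1 [c2 [v1 [v2 [slots em]]]]]]]] :=
  prog_spec sizesP blankP col1 col2 ks_lt ks_inj.
exists t, final, (fun i => \matrix_(a < n i, b < n i)
  rmem final 3 (\sum_(k < i) n k ^ 2 + a * n i + b)%N); split=> //.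
- apply: leq_trans lt _; rewrite mulnC mulnAC [X in (_ <= X)%N]mulnC leq_mul //.
  apply: leq_trans (prog_size_bound m n0 _ _ (inverse_ackermann_gt0 nL1)) _.
  by rewrite /bound nE // LqE Lq1E.
- move=> i im; have [lab [x [P [lab_le entries]]]] := em i im.
  apply: (laplacian_correct (KL i im) hL ho hLq hLq1 hwL _ _ P lab_le (w := rmem input 2)).
  + move=> r rL F; have [_ _ hF] := rows (Ordinal rL).
    have [e1 e2 e3 e4] := slots r rL.
    rewrite /row_val e1 e2 e3 e4 -hF; apply: eq_bigr => j _.
    by rewrite mxE.
  + move=> r rL; rewrite -[LHS]/(r \notin [seq imem input 3 j | j <- iota 0 (n0 + i)]).
    congr (~~ _).
    apply/mapP/idP => [[j] | rK].
      rewrite mem_iota -nE // => /andP[_ jn] ->.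
      by rewrite in_ks ?nth_index ?ks_Lq ?ks_in //; have := nE i im; lia.
    have : nth set0 Lq r \in take (n i) ks by rewrite hks.
    move=> /[dup] r_in; rewrite -index_mem size_takel => [jn|]; last first.
      by rewrite ks_size' nE // leq_add2l.
    exists (index (nth set0 Lq r) (take (n i) ks)); first by rewrite mem_iota -nE.
    rewrite in_ks; last by have := nE i im; lia.
    rewrite -(nth_take _ jn) nth_index // index_uniq //.
    by rewrite (perm_uniq hLq) enum_uniq.
  + by move=> j jn; rewrite /= (nth_map set0).
  + by rewrite /= nth_default // size_map.
  + by move=> a; apply: ks_in.
  + move=> a b; rewrite mxE.
    have [an bn] : (a < n0 + i)%N /\ (b < n0 + i)%N by rewrite -nE.
    have := entries a b an bn; rewrite !in_ks; [|lia|lia].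
    have -> : (\sum_(k < i) (n0 + k) ^ 2 = \sum_(k < i) n k ^ 2)%N.
      by apply: eq_bigr => k _; rewrite nE // ltnW // (leq_trans (ltn_ord k)).
    have -> : (\sum_(k < i) (n0 + k) = \sum_(k < i) n k)%N.
      by apply: eq_bigr => k _; rewrite nE // ltnW // (leq_trans (ltn_ord k)).
    rewrite -nE // => ->; congr (_ / _).
    rewrite /= (nth_weights _ set0 _ im) // => k km.
    by rewrite ks_size' nE // leq_add2l.
- by move=> i im a b; rewrite mxE.
Qed.
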